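(* Let $p\in[1,\infty]$, let $X$ be a Tychonoff space, and let $\mathcal{T}$ be a locally convex vector topology on $L(X)$ compatible with the duality $(L(X),C(X))$; write $L_{\mathcal{T}}(X)=(L(X),\mathcal{T})$. Then the following assertions are equivalent: (i) the space $C_p(X)$ is $p$-barrelled; (ii) every precompact (equivalently, bounded) subset of $C_p(X)$ is $(p,\infty)$-limited; (iii) $X$ has no infinite functionally bounded subsets; (iv) each bounded subset of $C_p(X)$ is $(p,q)$-limited for some (equivalently, for every) $q$ with $p\leq q\leq\infty$; (v) $L_{\mathcal{T}}(X)$ is quasi-complete; (vi) $L_{\mathcal{T}}(X)$ is sequentially complete; (vii) $L_{\mathcal{T}}(X)$ is locally complete.
   Context: All locally convex spaces are Hausdorff, over $\mathbb{F}\in\{\mathbb{R},\mathbb{C}\}$; $\omega=\{0,1,2,\dots\}$. $C_p(X)$ is the space $C(X)$ of all continuous $\mathbb{F}$-valued functions on $X$ with the topology of pointwise convergence (the subscript $p$ in $C_p(X)$ is not the number $p$). Its dual is identified with $L(X)$, the vector space with Hamel basis $X$, where $x\in X$ is identified with the Dirac measure $\delta_x$; so $(L(X),C(X))$ is a dual pair. ''$\mathcal{T}$ compatible with the duality $(L(X),C(X))$'' means that the topological dual of $(L(X),\mathcal{T})$ is $C(X)$. A subset $A$ of $X$ is functionally bounded if every $f\in C(X)$ is bounded on $A$. For an lcs $E$ with topological dual $E'$: a sequence $\{\chi_n\}_{n\in\omega}$ in $E'$ is weak$^\ast$ $p$-summable if $(\langle\chi_n,x\rangle)_n\in\ell_p$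 (or $\in c_0$ if $p=\infty$) for every $x\in E$. $E$ is $p$-barrelled if every weak$^\ast$ $p$-summable sequence in $E'$ is equicontinuous. With $\|\chi\|_A:=\sup\{|\chi(x)|:x\in A\cup\{0\}\}$, a non-empty subset $A$ of $E$ is $(p,q)$-limited if $(\|\chi_n\|_A)_n\in\ell_q$ if $q<\infty$, or $\|\chi_n\|_A\to0$ if $q=\infty$, for every weak$^\ast$ $p$-summable sequence $\{\chi_n\}$ in $E'$. $E$ is quasi-complete if each closed bounded subset of $E$ is complete; sequentially complete if each Cauchy sequence converges; locally complete if the closed absolutely convex hull of each null sequence in $E$ is compact. Precompact means totally bounded. *)

(* Defs.v *)
From HB Require Import structures.
From mathcomp Require Import all_boot all_order all_algebra complex.
From mathcomp Require Import finmap monalg.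
From mathcomp Require Import all_classical all_reals all_analysis.

Set Implicit Arguments.
Unset Strict Implicit.
Unset Printing Implicit Defensive.

Import Order.TTheory GRing.Theory Num.Theory.
Import numFieldNormedType.Exports.

Local Open Scope classical_set_scope.
Local Open Scope ring_scope.
Local Open Scope convex_scope.

Variant scalars := RealScalars | ComplexScalars.

Definition scalar_field (R : realType) (s : scalars) : numFieldType :=
  match s with RealScalars => R | ComplexScalars => R[i] end.

(* The norm of a [numFieldType] takes its values in the field itself; this is
   the same absolute value, but R-valued. *)
Definition modulus {R : realType} {s : scalars} : scalar_field R s -> R :=
  match s with
  | RealScalars => fun x : R => `|x|
  | ComplexScalars => fun z : R[i] => Normc.normc z
  end.

(* For p = +oo this is c_0, not l_oo. *)
Definition ell {R : realType} (p : \bar R) (a : R^nat) : Prop :=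
  match p with
  | r%:E => cvgn (series (fun n => `|a n| `^ r))
  | +oo%E => a @ \oo --> 0
  | -oo%E => False
  end.

Section LocallyConvexSpaces.
Context {K : numFieldType} {E : tvsType K}.
Implicit Types (A : set E) (F : set_system E).

(* [tvsType] does not require the uniformity of E to be the one induced by
   addition, so the uniform notions are expressed with neighbourhoods of 0. *)
Definition lc_cauchy F : Prop :=
  forall U : set E, nbhs 0 U ->
    exists2 B, F B & forall x y, B x -> B y -> U (x - y).

Definition lc_complete A : Prop :=
  forall F, ProperFilter F -> F A -> lc_cauchy F -> exists2 x, A x & F --> x.

Definition lc_bounded A : Prop :=
  forall U : set E, nbhs 0 U ->
    exists2 r : K, 0 < r & A `<=` [set r *: u | u in U].

Definition totally_bounded A : Prop :=
  forall U : set E, nbhs 0 U ->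
    exists2 D : set E, finite_set D & A `<=` [set d + u | d in D & u in U].

Definition absolutely_convex A : Prop :=
  forall (a b : K) x y, `|a| + `|b| <= 1 -> A x -> A y -> A (a *: x + b *: y).

Definition quasi_complete : Prop :=
  forall A, closed A -> lc_bounded A -> lc_complete A.

Definition sequentially_complete : Prop :=
  forall u : nat -> E, lc_cauchy (u @ \oo) -> exists l : E, u @ \oo --> l.

Definition locally_complete : Prop :=
  forall u : nat -> E, u @ \oo --> (0 : E) ->
    compact (closure (smallest absolutely_convex (range u))).

End LocallyConvexSpaces.
Arguments quasi_complete {K} E.
Arguments sequentially_complete {K} E.
Arguments locally_complete {K} E.

Record dual (K : numFieldType) (E : tvsType K) := Dual {
  dual_fun :> {linear E -> K^o};
  dual_continuous : continuous dual_fun }.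

Section Limited.
Context {R : realType} {s : scalars}.
Local Notation K := (scalar_field R s).
Context {E : tvsType K}.

Definition weak_star_summable (p : \bar R) (chi : nat -> dual E) : Prop :=
  forall x : E, ell p (fun n => modulus (chi n x)).

Definition p_barrelled (p : \bar R) : Prop :=
  forall chi : nat -> dual E, weak_star_summable p chi ->
    equicontinuous [set: nat] (fun n => chi n : E -> K^o).

Definition dual_seminorm (A : set E) (chi : dual E) : \bar R :=
  ereal_sup [set (modulus (chi x))%:E | x in A `|` [set 0]].

(* The finiteness clause makes membership in l_q, or c_0, a statement about a
   sequence of real numbers. *)
Definition limited (p q : \bar R) (A : set E) : Prop :=
  forall chi : nat -> dual E, weak_star_summable p chi ->
    (forall n, dual_seminorm A (chi n) \is a fin_num) /\
    ell q (fun n => fine (dual_seminorm A (chi n))).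

End Limited.
Arguments p_barrelled {R s} E p.

Lemma normr_conv_lt (K : numFieldType) (a b u v e : K) :
  0 < a -> 0 < b -> a + b = 1 -> `|u| < e -> `|v| < e ->
  `|a * u + b * v| < e.
Proof.
move=> a0 b0 ab1 ue ve; rewrite -[e]mul1r -ab1 mulrDl.
apply: le_lt_trans (ler_normD _ _) _.
by rewrite !normrM (gtr0_norm a0) (gtr0_norm b0) ltrD// ltr_pM2l.
Qed.

Section ContinuousFunctions.
Context {X : topologicalType} {K : numFieldType}.
Local Notation C := (continuousType X K^o).
Implicit Types f g h : C.

Let cts0 : continuous (fun _ : X => 0 : K^o).
Proof. by move=> x; exact: cvg_cst. Qed.

Let ctsD f g : continuous (fun x => f x + g x).
Proof. by move=> x; apply: cvgD; exact: cts_fun. Qed.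

Let ctsN f : continuous (fun x => - f x).
Proof. by move=> x; apply: cvgN; exact: cts_fun. Qed.

Let ctsZ (k : K) f : continuous (fun x => k *: f x).
Proof. by move=> x; apply: cvgZl_tmp; exact: cts_fun. Qed.

Let zero : C := mkcts cts0.
Let add f g : C := mkcts (@ctsD f g).
Let opp f : C := mkcts (@ctsN f).
Let scale (k : K) f : C := mkcts (@ctsZ k f).

Let addA : associative add.
Proof. by move=> f g h; apply/continuousEP => x /=; exact: addrA. Qed.
Let addC : commutative add.
Proof. by move=> f g; apply/continuousEP => x /=; exact: addrC. Qed.
Let add0 : left_id zero add.
Proof. by move=> f; apply/continuousEP => x /=; exact: add0r. Qed.
Let addN : left_inverse zero opp add.
Proof. by move=> f; apply/continuousEP => x /=; exact: addNr. Qed.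

HB.instance Definition _ := GRing.isZmodule.Build C addA addC add0 addN.

Let scaleA k l f : scale k (scale l f) = scale (k * l) f.
Proof. by apply/continuousEP => x /=; exact: scalerA. Qed.
Let scale1 : left_id 1 scale.
Proof. by move=> f; apply/continuousEP => x /=; exact: scale1r. Qed.
Let scaleDr : right_distributive scale +%R.
Proof. by move=> k f g; apply/continuousEP => x /=; exact: scalerDr. Qed.
Let scaleDl f : {morph scale^~ f : k l / k + l}.
Proof. by move=> k l; apply/continuousEP => x /=; exact: scalerDl. Qed.

HB.instance Definition _ :=
  GRing.Zmodule_isLmodule.Build K C scaleA scale1 scaleDr scaleDl.

Lemma ctsDE f g x : (f + g) x = f x + g x. Proof. by []. Qed.
Lemma ctsNE f x : (- f) x = - f x. Proof. by []. Qed.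
Lemma cts0E x : (0 : C) x = 0. Proof. by []. Qed.
Lemma ctsZE k f x : (k *: f) x = k *: f x. Proof. by []. Qed.

End ContinuousFunctions.

Definition Cp (X : topologicalType) (K : numFieldType) : Type :=
  initial_topology
    (fun f : continuousType X K^o => (f : X -> K^o) : {ptws X -> K^o}).

Section CpLocallyConvex.
Context {X : topologicalType} {K : numFieldType}.
Local Notation Cp := (Cp X K).

HB.instance Definition _ := GRing.Lmodule.copy Cp (continuousType X K^o).
HB.instance Definition _ := Topological.copy Cp
  (initial_topology
    (fun f : continuousType X K^o => (f : X -> K^o) : {ptws X -> K^o})).

Definition Cp_eval (x : X) (f : Cp) : K^o := (f : continuousType X K^o) x.

Lemma cvg_CpP (F : set_system Cp) (f : Cp) : Filter F ->
  F --> f <-> forall x, Cp_eval x g @[g --> F] --> Cp_eval x f.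
Proof.
move=> FF.
pose v : continuousType X K^o -> {ptws X -> K^o} := fun f => (f : X -> K^o).
have vF : {ptws, v @ F --> v f} <->
    forall x, Cp_eval x g @[g --> F] --> Cp_eval x f.
  exact: (@pointwise_cvgP X K^o (v @ F) (v f)).
rewrite -vF; split=> [Ff|vFf].
  by apply: cvg_comp Ff _; exact: (@initial_continuous _ _ v f).
move=> A [_ [[B oB <-] Bf BA]].
by apply: (filterS BA); apply: vFf; exact: open_nbhs_nbhs.
Qed.

Lemma Cp_eval_continuous x : continuous (Cp_eval x).
Proof. by move=> f; have := (@cvg_CpP (nbhs f) f _).1 (fun A => id); apply. Qed.

Let Cp_add_continuous : continuous (fun z : Cp * Cp => z.1 + z.2).
Proof.
move=> [f g]; apply/cvg_CpP => x.
have fx : Cp_eval x z.1 @[z --> ((f, g) : Cp * Cp)] --> Cp_eval x f.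
  apply: (@continuous_comp (Cp * Cp)%type Cp _ fst (Cp_eval x) (f, g)).
    exact: cvg_fst.
  exact: Cp_eval_continuous.
have gx : Cp_eval x z.2 @[z --> ((f, g) : Cp * Cp)] --> Cp_eval x g.
  apply: (@continuous_comp (Cp * Cp)%type Cp _ snd (Cp_eval x) (f, g)).
    exact: cvg_snd.
  exact: Cp_eval_continuous.
exact: (cvgD fx gx).
Qed.

Let Cp_scale_continuous : continuous (fun z : K^o * Cp => z.1 *: z.2).
Proof.
move=> [k f]; apply/cvg_CpP => x.
have kx : z.1 @[z --> ((k, f) : K^o * Cp)] --> k by exact: cvg_fst.
have fx : Cp_eval x z.2 @[z --> ((k, f) : K^o * Cp)] --> Cp_eval x f.
  apply: (@continuous_comp (K^o * Cp)%type Cp _ snd (Cp_eval x) (k, f)).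
    exact: cvg_snd.
  exact: Cp_eval_continuous.
exact: (cvgZ kx fx).
Qed.

Let Cp_locally_convex : exists2 B : set_system Cp,
  (forall b, b \in B -> convex_set b) & basis B.
Proof.
exists [set b | open b /\ convex_set b].
  by move=> b; rewrite inE => -[].
split; first by move=> b [].
move=> f.
have FF : Filter (filter_from
    [set U : set Cp | (open U /\ convex_set U) /\ U f] id).
  apply: filter_from_filter.
    by exists setT; split => //; split; [exact: openT|move=> *; rewrite inE].
  move=> A B [[oA cA] Af] [[oB cB] Bf]; exists (A `&` B) => //.
  split; last by split.
  split; first exact: openI.
  by move=> g h l; rewrite !in_setI => /andP[? ?] /andP[? ?];
    rewrite cA ?cB.
apply/cvg_CpP => x A; rewrite /= -nbhs_ballE => -[e e0 eA].
exists (Cp_eval x @^-1` ball (Cp_eval x f) e); last by move=> g; exact: eA.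
split; last exact: ballxx.
split.
  apply: open_comp; last exact: ball_open.
  by move=> g _; exact: Cp_eval_continuous.
apply/convex_setW => g h; rewrite !inE -ball_normE /= => fg fh l l0 l1.
rewrite inE /=.
have lE : l%:num + (1 - l%:num) = 1 :> K by rewrite addrC subrK.
have l'0 : 0 < 1 - l%:num :> K by rewrite subr_gt0.
have -> : Cp_eval x f - Cp_eval x (g <| l |> h) =
    l%:num * (Cp_eval x f - Cp_eval x g) +
    (1 - l%:num) * (Cp_eval x f - Cp_eval x h).
  by rewrite !mulrBr addrACA -mulrDl lE mul1r -opprD.
exact: normr_conv_lt.
Qed.

(* This factory only provides the uniformity induced by addition, hence the
   three further instances. *)
HB.instance Definition _ := PreTopologicalLmod_isTvs.Build K Cp
  Cp_add_continuous Cp_scale_continuous Cp_locally_convex.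
HB.instance Definition _ :=
  PreTopologicalNmodule_isTopologicalNmodule.Build Cp Cp_add_continuous.
HB.instance Definition _ :=
  TopologicalNmodule_isTopologicalLmodule.Build K Cp Cp_scale_continuous.
HB.instance Definition _ := Uniform_isTvs.Build K Cp Cp_locally_convex.

Lemma Cp_hausdorff : hausdorff_space Cp.
Proof.
move=> f g fg; apply/continuousEP => x.
have hK : hausdorff_space K^o by exact: norm_hausdorff.
apply: (hK (Cp_eval x f) (Cp_eval x g)) => A B fA gB.
have [h [hA hB]] :=
  fg _ _ (@Cp_eval_continuous x f _ fA) (@Cp_eval_continuous x g _ gB).
by exists (Cp_eval x h).
Qed.

End CpLocallyConvex.

Record topology_on (V : Type) := TopologyOn {
  open_set : set_system V;
  open_setT : open_set setT;
  open_setI : setI_closed open_set;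
  open_setU : forall G : set_system V, G `<=` open_set ->
    open_set (\bigcup_(A in G) A) }.

Definition topologized (V : Type) (T : topology_on V) : Type := V.

Section Topologized.
Context {K : numDomainType} {V : lmodType K} (T : topology_on V).

HB.instance Definition _ := GRing.Lmodule.copy (topologized T) V.

Let bigU (I : Type) (f : I -> set V) :
  (forall i, open_set T (f i)) -> open_set T (\bigcup_i f i).
Proof.
move=> fo; rewrite -(bigcup_image setT f id).
by apply: open_setU => _ [i _ <-].
Qed.

HB.instance Definition _ := isOpenTopological.Build (topologized T)
  (open_setT T) (@open_setI _ T) bigU.

End Topologized.

Record lc_topology (K : numFieldType) (V : lmodType K) := LcTopology {
  lc_base :> topology_on V;
  lc_add_continuous : continuous
    (fun z : topologized lc_base * topologized lc_base => z.1 + z.2);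
  lc_scale_continuous : continuous
    (fun z : K^o * topologized lc_base => z.1 *: z.2);
  lc_convex : exists2 B : set_system (topologized lc_base),
    (forall b, b \in B -> convex_set b) & basis B;
  lc_hausdorff : hausdorff_space (topologized lc_base) }.

Definition lc_space (K : numFieldType) (V : lmodType K) (T : lc_topology V)
  : Type := topologized T.

Section LcSpace.
Context {K : numFieldType} {V : lmodType K} (T : lc_topology V).

HB.instance Definition _ := GRing.Lmodule.copy (lc_space T) (topologized T).
HB.instance Definition _ := Topological.copy (lc_space T) (topologized T).
HB.instance Definition _ := PreTopologicalLmod_isTvs.Build K (lc_space T)
  (@lc_add_continuous _ _ T) (@lc_scale_continuous _ _ T) (lc_convex T).
HB.instance Definition _ :=
  PreTopologicalNmodule_isTopologicalNmodule.Build (lc_space T)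
    (@lc_add_continuous _ _ T).
HB.instance Definition _ :=
  TopologicalNmodule_isTopologicalLmodule.Build K (lc_space T)
    (@lc_scale_continuous _ _ T).
HB.instance Definition _ := Uniform_isTvs.Build K (lc_space T) (lc_convex T).

End LcSpace.

(* Finitely supported functions on X; the Hamel basis is x |-> << x >>. *)
Definition L (X : topologicalType) (K : numFieldType) : lmodType K :=
  {malg K[X]}.

Section Duality.
Context {X : topologicalType} {K : numFieldType}.

Definition pairing (chi : L X K) (f : X -> K) : K :=
  \sum_(x <- msupp chi) chi@_x * f x.

Definition compatible (T : lc_topology (L X K)) : Prop :=
  forall phi : {linear lc_space T -> K^o},
    continuous phi <->
    exists f : continuousType X K^o, forall chi : L X K, phi chi = pairing chi f.

End Duality.

Definition functionally_bounded (X : topologicalType) (K : numFieldType)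
    (A : set X) : Prop :=
  forall f : continuousType X K^o, [bounded f x | x in A].

Definition tychonoff_space (X : topologicalType) : Prop :=
  completely_regular_space X /\ hausdorff_space X.

(* Main.v *)
Require Import Defs.
From HB Require Import structures.
From mathcomp Require Import all_boot all_order all_algebra complex.
From mathcomp Require Import finmap monalg.
From mathcomp Require Import all_classical all_reals all_analysis.
From mathcomp Require Import ring lra.

(** Each assertion is compared with one condition on X: every functionally
    bounded subset is finite.

    If it holds, weakly bounded subsets of L(X) live on finitely many points.
    Indeed the supports of the members of a weakly bounded set B have a
    functionally bounded union: otherwise a gliding hump produces a continuous
    function, a locally finite sum of bumps, on which B is unbounded
    ([supports_functionally_bounded]). A weak* p-summable sequence in the dual
    of C_p(X) is a weakly bounded sequence in L(X), so it is a finite sum of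
    terms c_{n,x} delta_x with (c_{n,x})_n in l_p; equicontinuity and the
    limited property are then read off ([finite_p_barrelled],
    [finite_limited]). In L(X), closed bounded sets are closed in a compact set
    of the finite-dimensional span of finitely many Dirac measures, hence
    compact, which gives all forms of completeness
    ([finite_weakly_bounded_compact]).

    If it fails, an infinite functionally bounded set contains points x_n with
    bumps g_n of disjoint supports ([disjoint_bumps]). In C_p(X) the functions
    2^n g_n form a null sequence, while the functionals 2^-n delta_{x_n} form a
    weak* p-summable sequence with value 1 at the corresponding terms
    ([functionally_bounded_witness]): this contradicts p-barrelledness and
    every limited property. In L(X) the measures 2^-n delta_{x_n} form a null
    sequence, and the partial sums of sum_n 2^-(2n+1) delta_{x_n} form a Cauchy
    sequence in its absolutely convex hull; a cluster point would have an
    infinite support ([dirac_sum_cluster]), so L(X) is neither sequentially nor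
    locally complete.

    The last step is needed for an arbitrary compatible topology, and so uses
    that its bounded sets are the weakly bounded ones
    ([weakly_bounded_bounded]). That is a uniform boundedness argument on the
    functionals dominated by a continuous seminorm; the norming functionals
    come from the Hahn-Banach theorem, proved here by taking a minimal
    sublinear functional ([Hahn_Banach_support]). *)

Set Implicit Arguments.
Unset Strict Implicit.
Unset Printing Implicit Defensive.

Import Order.TTheory GRing.Theory Num.Theory.
Import numFieldNormedType.Exports.

Local Open Scope classical_set_scope.
Local Open Scope ring_scope.

(** * Real and complex scalars *)

Section Scalars.
Context {R : realType} {s : scalars}.
Local Notation K := (scalar_field R s).

(** The inclusion of the reals in the field of scalars. *)
Definition emb : R -> K :=
  match s with RealScalars => id | ComplexScalars => fun r => r%:C%C end.

End Scalars.

Section ScalarTheory.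
Context {R : realType} {s : scalars}.
Local Notation K := (scalar_field R s).
Implicit Types (r t : R) (a b k : K).

Lemma normr_modulus k : `|k| = emb (modulus k) :> K.
Proof. by case: s k. Qed.

Lemma embD r t : emb (r + t) = emb r + emb t :> K.
Proof. by case: s => //=; rewrite rmorphD. Qed.

Lemma embM r t : emb (r * t) = emb r * emb t :> K.
Proof. by case: s => //=; rewrite rmorphM. Qed.

Lemma emb0 : emb 0 = 0 :> K.
Proof. by case: s. Qed.

Lemma emb1 : emb 1 = 1 :> K.
Proof. by case: s. Qed.

Lemma embN r : emb (- r) = - emb r :> K.
Proof. by case: s => //=; rewrite rmorphN. Qed.

Lemma embB r t : emb (r - t) = emb r - emb t :> K.
Proof. by rewrite embD embN. Qed.

Lemma embV r : emb r^-1 = (emb r)^-1 :> K.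
Proof. by case: s => //=; rewrite fmorphV. Qed.

Lemma ler_emb r t : (emb r <= emb t :> K) = (r <= t).
Proof. by case: s => //=; rewrite lecR. Qed.

Lemma ltr_emb r t : (emb r < emb t :> K) = (r < t).
Proof. by case: s => //=; rewrite ltcR. Qed.

Lemma emb_inj : injective (emb : R -> K).
Proof. by case: s => //= r t []. Qed.

Lemma modulus_emb r : modulus (emb r : K) = `|r|.
Proof.
by apply: emb_inj; rewrite -normr_modulus; case: s => //=;
  rewrite normc_def /= expr0n addr0 sqrtr_sqr.
Qed.

Lemma modulus_ge0 k : 0 <= modulus k.
Proof. by rewrite -ler_emb -normr_modulus emb0. Qed.

Lemma modulusD a b : modulus (a + b) <= modulus a + modulus b.
Proof. by rewrite -ler_emb embD -!normr_modulus ler_normD. Qed.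

Lemma modulusM a b : modulus (a * b) = modulus a * modulus b.
Proof. by apply: emb_inj; rewrite embM -!normr_modulus normrM. Qed.

Lemma modulusN a : modulus (- a) = modulus a.
Proof. by apply: emb_inj; rewrite -!normr_modulus normrN. Qed.

Lemma modulusV a : modulus a^-1 = (modulus a)^-1.
Proof. by apply: emb_inj; rewrite embV -!normr_modulus normfV. Qed.

Lemma modulus_eq0 a : (modulus a == 0) = (a == 0).
Proof. by rewrite -(inj_eq emb_inj) -normr_modulus emb0 normr_eq0. Qed.

Lemma modulus0 : modulus (0 : K) = 0.
Proof. by apply/eqP; rewrite modulus_eq0. Qed.

Lemma modulus1 : modulus (1 : K) = 1.
Proof. by rewrite -emb1 modulus_emb normr1. Qed.

Lemma modulus_sum (I : Type) (l : seq I) (P : pred I) (F : I -> K) :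
  modulus (\sum_(i <- l | P i) F i) <= \sum_(i <- l | P i) modulus (F i).
Proof.
elim/big_ind2: _ => //; first by rewrite modulus0.
by move=> a r b t ar bt; rewrite (le_trans (modulusD _ _)) // lerD.
Qed.

(** Positive scalars are real, so radii and gauges may be taken in R. *)
Lemma gt0_emb k : 0 < k -> exists2 r : R, 0 < r & k = emb r.
Proof.
move=> k0; have kE : k = emb (modulus k) by rewrite -normr_modulus gtr0_norm.
by exists (modulus k) => //; rewrite -ltr_emb -kE emb0.
Qed.

Lemma normr_lt_emb k r : (`|k| < emb r) = (modulus k < r).
Proof. by rewrite normr_modulus ltr_emb. Qed.

Lemma nbhs_scalarP (x : K^o) (A : set K^o) :
  nbhs x A <-> exists2 e : R, 0 < e & forall y : K^o,
    modulus (x - y : K) < e -> A y.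
Proof.
rewrite -nbhs_ballE; split=> [[e e0 eA]|[e e0 eA]].
  have [r r0 er] := gt0_emb e0; exists r => // y xy.
  by apply: eA; rewrite -ball_normE /= er normr_lt_emb.
exists (emb e); first by rewrite /= -emb0 ltr_emb.
by move=> y; rewrite -ball_normE /= normr_lt_emb; exact: eA.
Qed.

Lemma modulus_continuous : continuous (modulus : K^o -> R).
Proof.
move=> x A; rewrite /= -nbhs_ballE => -[e e0 eA].
apply/nbhs_scalarP; exists e => // y xy; apply: eA; rewrite /ball /=.
apply: le_lt_trans xy; rewrite ler_norml; apply/andP; split.
  rewrite lerNl opprB lerBlDl.
  by rewrite -{1}[y](subrK x) (le_trans (modulusD _ _)) // addrC -opprB
    modulusN.
by rewrite lerBlDl -{1}[x](subrK y) (le_trans (modulusD _ _)) // addrC.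
Qed.

Lemma emb_continuous : continuous (emb : R -> K^o).
Proof.
move=> x A /nbhs_scalarP [e e0 eA]; rewrite /= -nbhs_ballE; exists e => // y.
by rewrite /ball /= => xy; apply: eA; rewrite -embB modulus_emb.
Qed.

(** As a topological space K is R or R^2, and the Heine-Borel theorem applies.
    *)
Lemma disc_compact (M : R) :
  exists2 C : set K^o, compact C & forall k : K, modulus k <= M -> C k.
Proof.
pose g : R * R -> K := match s return R * R -> scalar_field R s with
  RealScalars => fst | ComplexScalars => fun z => (z.1 +i* z.2)%C end.
have gE : forall a, exists u v, [/\ a = g (u, v),
  `|u| <= modulus a & `|v| <= modulus a].
  rewrite /g; case: s => [a|[u v]] /=; first by exists a, 0; rewrite normr0.
  by exists u, v; split => //; rewrite -sqrtr_sqr ler_wsqrtr // ?lerDl ?lerDr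
    sqr_ge0 //.
have sq (a b : R) : a ^+ 2 + b ^+ 2 <= (`|a| + `|b|) ^+ 2.
  by rewrite sqrrD !real_normK ?num_real // addrAC lerDl mulrn_wge0 ?mulr_ge0.
have gB : forall u v u' v', modulus (g (u, v) - g (u',
  v')) <= `|u - u'| + `|v - v'|.
  rewrite /g; case: s => [|] u v u' v' /=; first by rewrite lerDl.
  by rewrite -[leRHS]ger0_norm ?addr_ge0 // -sqrtr_sqr ler_wsqrtr //.
pose I := `[- M, M]%classic : set R.
exists (g @` (I `*` I)); last first.
  move=> a aM; have [u [v [aE ua va]]] := gE a; exists (u, v) => //.
  split; rewrite /I /= in_itv /= -ler_norml.
    exact: (le_trans ua aM).
  exact: (le_trans va aM).
apply: (@continuous_compact _ K^o g); last first.
  by apply: compact_setX; exact: segment_compact.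
apply: continuous_subspaceT => -[u v] A /nbhs_scalarP [e e0 eA].
exists (ball u (e / 2), ball v (e / 2)).
  by split; apply: nbhsx_ballx; rewrite divr_gt0.
move=> [u' v'] [/= uu vv]; apply: eA; apply: le_lt_trans (gB _ _ _ _) _.
by rewrite [ltRHS]splitr ltrD.
Qed.

End ScalarTheory.

(** * The pairing of L(X) with C(X), and bump functions *)

Section Pairing.
Context {R : realType} {s : scalars} {X : topologicalType}.
Local Notation K := (scalar_field R s).
Local Notation C := (continuousType X K^o).
Implicit Types (l : L X K) (f g : C) (x y : X).

Lemma pairingEw (D : {fset X}) l (f : X -> K) :
  (msupp l `<=` D)%fset -> pairing l f = \sum_(x <- D) l@_x * f x.
Proof.
move=> lD; rewrite /pairing; apply: big_fset_incl => // x _ xl.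
by rewrite mcoeff_outdom // mul0r.
Qed.

Lemma pairingDl l1 l2 (f : X -> K) :
  pairing (l1 + l2) f = pairing l1 f + pairing l2 f.
Proof.
pose D := (msupp l1 `|` msupp l2)%fset.
rewrite !(@pairingEw D) ?fsubsetUl ?fsubsetUr ?msuppD_le // -big_split /=.
by apply: eq_bigr => x _; rewrite mcoeffD mulrDl.
Qed.

Lemma pairingZl (k : K) l (f : X -> K) : pairing (k *: l) f = k * pairing l f.
Proof.
rewrite (pairingEw _ (msuppZ_le k l)) mulr_sumr.
by apply: eq_bigr => x _; rewrite mcoeffZ mulrA.
Qed.

Lemma pairing0l (f : X -> K) : pairing 0 f = 0.
Proof. by rewrite -(scale0r (0 : L X K)) pairingZl mul0r. Qed.

Lemma pairing_suml (I : Type) (r : seq I) (P : pred I) (F : I -> L X K)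
    (f : X -> K) :
  pairing (\sum_(i <- r | P i) F i) f = \sum_(i <- r | P i) pairing (F i) f.
Proof.
exact: (big_morph (fun l => pairing l f) (fun l1 l2 => pairingDl l1 l2 f)
  (pairing0l f)).
Qed.

Lemma pairing_dirac x (f : X -> K) : pairing (<< x >> : L X K) f = f x.
Proof.
rewrite (@pairingEw [fset x]%fset) ?msuppU_le //.
by rewrite big_seq_fset1 mcoeffUU mul1r.
Qed.

Lemma pairing_eq0 l (f : X -> K) :
  (forall x, x \in msupp l -> f x = 0) -> pairing l f = 0.
Proof.
by move=> f0; apply: big1_fset => x xl _; rewrite f0 // mulr0.
Qed.

Lemma pairing_single l (f : X -> K) x :
  (forall y, y \in msupp l -> y <> x -> f y = 0) ->
  pairing l f = l@_x * f x.
Proof.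
move=> f0; have [xl|xl] := boolP (x \in msupp l); last first.
  rewrite mcoeff_outdom // mul0r; apply: pairing_eq0 => y yl.
  by apply: f0 => // yx; rewrite -yx yl in xl.
rewrite /pairing (big_fsetD1 x) //= big1_fset ?addr0 // => y.
by rewrite !inE => /andP[/eqP yx yl] _; rewrite f0 // mulr0.
Qed.

Lemma pairingDr l f g : pairing l (f + g) = pairing l f + pairing l g.
Proof.
rewrite /pairing -big_split /=.
by apply: eq_bigr => x _; rewrite ctsDE mulrDr.
Qed.

Lemma pairingZr (k : K) l f : pairing l (k *: f) = k * pairing l f.
Proof.
rewrite /pairing mulr_sumr.
by apply: eq_bigr => x _; rewrite ctsZE /GRing.scale /= mulrCA.
Qed.

Lemma L_decomp l : l = \sum_(x <- msupp l) l@_x *: (<< x >> : L X K).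
Proof.
apply/malgP => y; rewrite raddf_sum /=.
have [yl|yl] := boolP (y \in msupp l).
  rewrite (big_fsetD1 y) //= big1_fset => [|x].
    by rewrite addr0 mcoeffZ mcoeffUU mulr1.
  by rewrite !inE => /andP[xy _] _; rewrite mcoeffZ mcoeffU (negPf xy) mulr0.
rewrite mcoeff_outdom // big1_fset // => x xl _.
rewrite mcoeffZ mcoeffU; case: eqP => [xy|]; last by rewrite mulr0.
by rewrite -xy xl in yl.
Qed.

End Pairing.

Section Tychonoff.
Context {R : realType} {s : scalars} {X : topologicalType}.
Context (tX : tychonoff_space X).
Local Notation K := (scalar_field R s).
Local Notation C := (continuousType X K^o).

Lemma separating_function x (B : set X) : closed B -> ~ B x ->
  exists e : C, e x = 1 /\ forall y, B y -> e y = 0.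
Proof.
move=> cB Bx; have sep := tX.1 x B cB Bx.
pose u : X -> R := Urysohn [set x] B.
have uc : continuous u by exact: Urysohn_continuous.
have ec : continuous (fun y => emb (1 - u y) : K^o).
  move=> y; apply: (@continuous_comp X R K^o (fun y => 1 - u y) emb).
    by apply: cvgB; [exact: cvg_cst|exact: uc].
  exact: emb_continuous.
exists (mkcts ec); split => [|y By].
  rewrite [LHS](_ : _ = emb (1 - u x)) //.
  have -> : u x = 0 by apply: (Urysohn_sub0 sep); exists x.
  by rewrite subr0 emb1.
rewrite [LHS](_ : _ = emb (1 - u y)) //.
have -> : u y = 1 by apply: (Urysohn_sub1 sep); exists y.
by rewrite subrr emb0.
Qed.

Lemma fset_closed (D : {fset X}) : closed [set y | y \in D].
Proof.
have [+ _] := @accessible_finite_set_closed X.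
by move=> /(_ (hausdorff_accessible tX.2)); apply; exact: finite_fset.
Qed.

(** Pairing with e reads off the coordinate at x of an element of L(X)
    supported in D. *)
Lemma coordinate_function (D : {fset X}) x :
  exists e : C, e x = 1 /\ forall y, y \in D -> y <> x -> e y = 0.
Proof.
have [| |e [e1 e0]] := @separating_function x [set y | y \in (D `\ x)%fset].
- exact: fset_closed.
- by rewrite /= fsetD11.
exists e; split => // y yD /eqP yx; apply: e0.
by rewrite /= !inE yx.
Qed.

(** Separate two points of O and A by a function m with m a = 1 and m b = 0. As
    {m < 2/3} and {1/3 < m} cover O, one of them, O', contains infinitely many
    points of A; then a or b has a neighbourhood disjoint from O'. *)
Lemma split_infinite (A O : set X) : open O -> infinite_set (O `&` A) ->
  exists x U O', [/\ A x, open U, U x, U `<=` O &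
    [/\ open O', O' `<=` O, infinite_set (O' `&` A) & O' `&` U = set0]].
Proof.
move=> oO iO.
have c13 : 1 / 3 < 2 / 3 :> R by lra.
have c01 : 0 < 1 / 3 :> R by lra.
have c21 : 2 / 3 < 1 :> R by lra.
have [a [Oa Aa]] : (O `&` A) !=set0 by apply: infinite_setN0.
have [b [[Ob Ab] ba]] : ((O `&` A) `\ a) !=set0.
  by apply: infinite_setN0; apply: (infinite_setD iO); exact: finite_set1.
have [e [ea eb]] := @separating_function a [set b]
  (@accessible_closed_set1 X (hausdorff_accessible tX.2) b) (fun ab =>
    ba (esym ab)).
pose m y : R := modulus (e y).
have mc : continuous m.
  move=> y; apply: (@continuous_comp X K^o R e modulus); first exact: cts_fun.
  exact: modulus_continuous.
pose lo := m @^-1` [set t | t < 2 / 3 :> R].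
pose hi := m @^-1` [set t | 1 / 3 < t :> R].
have olo (c : R) : open (m @^-1` [set t | t < c]).
  by apply: open_comp => [y _|]; [exact: mc|exact: open_lt].
have ohi (c : R) : open (m @^-1` [set t | c < t]).
  by apply: open_comp => [y _|]; [exact: mc|exact: open_gt].
have ma : m a = 1 by rewrite /m ea modulus1.
have mb : m b = 0 by rewrite /m eb // modulus0.
have [ilo|ilo] := pselect (infinite_set ((O `&` lo) `&` A)).
  exists a, (O `&` m @^-1` [set t | 2 / 3 < t :> R]), (O `&` lo); split => //.
  - exact: openI.
  - by split => //=; rewrite ma.
  split => //; first exact: (openI oO (olo _)).
  - by rewrite -subset0 => y [[_ /= lo_y] [_ /= hi_y]];
    have := lt_trans lo_y hi_y; rewrite ltxx.
exists b, (O `&` m @^-1` [set t | t < 1 / 3 :> R]), (O `&` hi); split => //.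
- exact: openI.
- by split => //=; rewrite mb.
split => //; first exact: (openI oO (ohi _)).
- move=> fhi; apply: iO; apply: (@sub_finite_set _ _
    (((O `&` lo) `&` A) `|` ((O `&` hi) `&` A))).
    move=> y [Oy Ay]; have [mlt|mge] := ltP (m y) (2 / 3).
      by left; split => //; split.
    by right; split => //; split => //=; exact: lt_le_trans mge.
  by rewrite finite_setU; split => //; exact: contrapT.
- by rewrite -subset0 => y [[_ /= lo_y] [_ /= hi_y]];
  have := lt_trans lo_y hi_y; rewrite ltxx.
Qed.

(** Iterating the splitting puts the points x_n in disjoint open sets U_n, and
    g_n is a bump at x_n that vanishes off U_n. *)
Lemma disjoint_bumps (A : set X) : infinite_set A ->
  exists (x : nat -> X) (g : nat -> C),
    [/\ forall n, A (x n), forall n, g n (x n) = 1 &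
        forall m n y, g m y <> 0 -> g n y <> 0 -> m = n].
Proof.
move=> iA; have [a Aa] := infinite_setN0 iA.
pose T := (X * set X * set X)%type.
have step (O : set X) : exists t : T, open O -> infinite_set (O `&` A) ->
    [/\ A t.1.1, open t.1.2, t.1.2 t.1.1, t.1.2 `<=` O &
    [/\ open t.2, t.2 `<=` O, infinite_set (t.2 `&` A) & t.2 `&` t.1.2 = set0]].
  have [[oO iO]|no] := pselect (open O /\ infinite_set (O `&` A)).
    have [x [U [V H]]] := split_infinite oO iO.
    by exists (x, U, V).
  by exists (a, set0, set0) => oO iO; case: no.
pose next O := projT1 (cid (step O)).
have nextP O := projT2 (cid (step O)).
pose O := fix O n := if n is n'.+1 then (next (O n')).2 else setT.
have OP n : open (O n) /\ infinite_set (O n `&` A).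
  elim: n => [|n [oO iO]] /=; first by split; [exact: openT|rewrite setTI].
  by have [_ _ _ _ [oO1 _ iO1 _]] := nextP (O n) oO iO.
pose U n := (next (O n)).1.2; pose x n := (next (O n)).1.1.
have P n := nextP (O n) (OP n).1 (OP n).2.
have Odec m n : (m <= n)%N -> O n `<=` O m.
  move=> /subnK <-; elim: (n - m)%N => // k IH; rewrite addSn /=.
  by have [_ _ _ _ [_ sub _ _]] := P (k + m)%N; exact: subset_trans sub IH.
have Udisj m n y : (m < n)%N -> U m y -> U n y -> False.
  move=> mn Um Un; have [_ _ _ sub _] := P n; have [_ _ _ _ [_ _ _ d]] := P m.
  by have : set0 y by rewrite -d; split => //; apply: (Odec m.+1 n mn);
    exact: sub.
have bump n : exists g : C, g (x n) = 1 /\ forall y, (~` U n) y -> g y = 0.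
  apply: separating_function; first by apply: open_closedC; have [] := P n.
  by apply; have [] := P n.
pose g n := projT1 (cid (bump n)).
have gP n : g n (x n) = 1 /\ forall y, (~` U n) y -> g n y = 0.
  exact: (projT2 (cid (bump n))).
exists x, g; split => [n|n|m n y gm gn].
- by have [] := P n.
- exact: (gP n).1.
have inU k : g k y <> 0 -> U k y by move=> gk; apply: contrapT => /(gP k).2.
have [/Udisj|/Udisj|//] := ltngtP m n.
- by move=> /(_ y (inU _ gm) (inU _ gn)).
- by move=> /(_ y (inU _ gn) (inU _ gm)).
Qed.

End Tychonoff.

(** * The Hahn-Banach theorem *)

Section Sublinear.
Context {R : realType} {E : lmodType R}.
Implicit Types (p q : E -> R) (x y u : E).

Definition sublinear q :=
  (forall x y, q (x + y) <= q x + q y) /\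
  (forall (a : R) x, 0 < a -> q (a *: x) = a * q x).

Lemma sublinear0 q : sublinear q -> q 0 = 0.
Proof.
move=> [_ qZ]; have := qZ 2 0 (ltr0n _ 2); rewrite scaler0 => q2.
by apply/eqP; rewrite -(subrr (q 0)) -[X in _ == X - _]mulr1 q2; apply/eqP; lra.
Qed.

Lemma sublinear_ge q x : sublinear q -> - q (- x) <= q x.
Proof.
move=> sq; rewrite -subr_ge0 opprK -(sublinear0 sq) -{1}(subrr x).
exact: sq.1.
Qed.

(** Stated for families that are directed only as far as sublinearity needs it,
    to cover both chains of sublinear functionals and the infimum of q (x + t
    y) - t q y over t. *)
Lemma inf_sublinear (I : Type) (D : set I) (F : I -> E -> R) :
    D !=set0 -> (forall x, exists b, forall i, D i -> b <= F i x) ->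
    (forall i j x y, D i -> D j ->
      exists2 k, D k & F k (x + y) <= F i x + F j y) ->
    (forall i (a : R) x, D i -> 0 < a ->
      exists2 k, D k & F k (a *: x) <= a * F i x) ->
  sublinear (fun x => inf [set F i x | i in D]) /\
  forall i x, D i -> inf [set F i x | i in D] <= F i x.
Proof.
move=> [i0 Di0] lb FD FZ; set m := fun x => _.
have mle i x : D i -> m x <= F i x.
  move=> Di; apply: ge_inf; last by exists i.
  by have [b bF] := lb x; exists b => _ [j Dj <-]; exact: bF.
have lem x b : (forall i, D i -> b <= F i x) -> b <= m x.
  move=> bF; apply: lb_le_inf; first by exists (F i0 x), i0.
  by move=> _ [j Dj <-]; exact: bF.
split => //; split => [x y|a x a0].
  rewrite -lerBlDr; apply: (lem) => i Di; rewrite lerBlDr [leRHS]addrC -lerBlDr.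
  apply: (lem) => j Dj; rewrite lerBlDr [leRHS]addrC.
  by have [k Dk] := FD i j x y Di Dj; apply: le_trans; exact: mle.
have mZ (b : R) y : 0 < b -> m (b *: y) <= b * m y.
  move=> b0; rewrite -ler_pdivrMl //; apply: (lem) => i Di.
  rewrite ler_pdivrMl //; have [k Dk] := FZ i b y Di b0.
  by apply: le_trans; exact: mle.
apply/eqP; rewrite eq_le mZ //=.
rewrite -ler_pdivlMl //; rewrite -{1}[x]scale1r -(mulVf (lt0r_neq0 a0))
  -scalerA.
by rewrite mZ // invr_gt0.
Qed.

Definition translate q y t : E -> R := fun x => q (x + t *: y) - t * q y.

(** The infimum of these functionals is at most q (at t = 0) and at most q (x +
    y) - q y (at t = 1): it lowers q towards a functional that is additive in
    the direction y. *)
Lemma translate_inf_sublinear q y : sublinear q ->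
  sublinear (fun x => inf [set translate q y t x | t in [set t | 0 <= t]]) /\
  forall t x, 0 <= t ->
    inf [set translate q y t x | t in [set t | 0 <= t]] <= translate q y t x.
Proof.
move=> sq; have [qD qZ] := sq; apply: inf_sublinear.
- by exists 0 => /=.
- move=> x; exists (- q (- x)) => t /=; rewrite le_eqVlt => /orP[/eqP <-|t0].
    by rewrite /translate scale0r addr0 mul0r subr0 sublinear_ge.
  rewrite /translate lerBrDr addrC lerBlDr -qZ //.
  by have := qD (x + t *: y) (- x); rewrite [x + _]addrC addrK.
- move=> i j x y' /= i0 j0; exists (i + j); rewrite /= ?addr_ge0 //.
  rewrite /translate scalerDl addrACA mulrDl opprD.
  by rewrite [leRHS]addrACA lerD2r.
- move=> i a x /= i0 a0; exists (a * i); first by rewrite /= mulr_ge0 // ltW.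
  by rewrite /translate -scalerA -scalerDr qZ // -mulrA -mulrBr.
Qed.

(** Minimality forces q to equal the infimum of its translates along y, and the
    translate at t = 1 then gives q x + q y <= q (x + y). *)
Lemma minimal_sublinear_linear q : sublinear q ->
    (forall q', sublinear q' -> (forall x, q' x <= q x) -> q' = q) ->
  (forall x y, q (x + y) = q x + q y) /\
  (forall (a : R) x, q (a *: x) = a * q x).
Proof.
move=> sq qmin; have [qD qZ] := sq.
have add x y : q (x + y) = q x + q y.
  apply/eqP; rewrite eq_le qD /= -lerBrDr.
  have [sm mle] := translate_inf_sublinear y sq.
  have mq := qmin _ sm.
  rewrite -{1}mq => [|z]; last first.
    have := mle 0 z (lexx _).
    by rewrite /translate scale0r addr0 mul0r subr0.
  by have := mle 1 x ler01; rewrite /translate scale1r mul1r.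
have q0 := sublinear0 sq.
have qN x : q (- x) = - q x.
  by apply/eqP; rewrite -subr_eq0 opprK -add addNr q0.
split => // a x; have [a0|a0|<-] := ltgtP 0 a; first exact: qZ.
  apply: oppr_inj; rewrite -qN -scaleNr qZ ?oppr_gt0 // mulNr //.
by rewrite scale0r mul0r.
Qed.

(** Zorn's lemma, downwards: the pointwise infimum of a chain is finite, as
    each member is at least - p (- x) at x. *)
Lemma minimal_sublinear_exists p : sublinear p ->
  exists q, [/\ sublinear q, forall x, q x <= p x &
    forall q', sublinear q' -> (forall x, q' x <= q x) -> q' = q].
Proof.
move=> sp; pose T := {q : E -> R | sublinear q /\ forall x, q x <= p x}.
pose ge (f g : T) : bool := `[< forall x, sval g x <= sval f x >].
have [//|f g h /asboolP fg /asboolP gh|[f Pf] [g Pg] /asboolP /= fg /asboolP /=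
  gf|A tA|[q [sq qp]] qmin]
    := @Zorn T ge.
- by move=> f; apply/asboolP => x.
- by apply/asboolP => x; exact: le_trans (gh x) (fg x).
- apply: eq_exist => /=; apply/funext => x.
  by apply/eqP; rewrite eq_le gf fg.
- have [A0|/nonemptyPn A0] := pselect (A !=set0); last first.
    by exists (exist _ p (conj sp (fun x => lexx _))) => f; rewrite A0.
  have [| | |sm mle] := @inf_sublinear T A (fun f => sval f) A0.
  + move=> x; exists (- p (- x)) => f _; have [sf fp] := svalP f.
    by apply: le_trans (sublinear_ge x sf); rewrite lerN2.
  + move=> f g x y Af Ag; have [/asboolP fg|/asboolP gf] := tA f g Af Ag.
      by exists g => //; rewrite (le_trans ((svalP g).1.1 _ _)) // lerD2r.
    by exists f => //; rewrite (le_trans ((svalP f).1.1 _ _)) // lerD2l.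
  + by move=> f a x Af a0; exists f => //; rewrite (svalP f).1.2.
  have [f0 Af0] := A0.
  have mp x : inf [set sval f x | f in A] <= p x.
    exact: le_trans (mle f0 x Af0) ((svalP f0).2 x).
  pose P q := sublinear q /\ forall x, q x <= p x.
  exists (exist P (fun x => inf [set sval f x | f in A]) (conj sm mp)) => f Af.
  apply/asboolP => x /=.
  exact: mle.
exists q; split => // q' sq' q'q.
have q'p x : q' x <= p x by exact: le_trans (q'q x) (qp x).
pose P q := sublinear q /\ forall x, q x <= p x.
have : exist P q' (conj sq' q'p) = exist P q (conj sq qp).
  by apply: qmin; apply/asboolP.
by move=> /(congr1 sval).
Qed.

(** The infimum of the translates of p along u is at most - p u at - u, so a
    minimal, hence linear, functional f below it satisfies f u >= p u. *)
Lemma Hahn_Banach_support p u : sublinear p ->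
  exists f : E -> R,
    [/\ forall x y, f (x + y) = f x + f y,
        forall (a : R) x, f (a *: x) = a * f x,
        forall x, f x <= p x & f u = p u].
Proof.
move=> sp; have [sm mle] := translate_inf_sublinear u sp.
have [q [sq qm qmin]] := minimal_sublinear_exists sm.
have [qD qZ] := minimal_sublinear_linear sq qmin.
have qp x : q x <= p x.
  have := mle 0 x (lexx _).
  by rewrite /translate scale0r addr0 mul0r subr0; exact: le_trans (qm x).
exists q; split => //; apply/eqP; rewrite eq_le qp /=.
have := le_trans (qm (- u)) (mle 1 (- u) ler01).
rewrite /translate scale1r addNr sublinear0 // mul1r sub0r.
by rewrite -scaleN1r qZ mulN1r lerN2.
Qed.

End Sublinear.

(** * Seminorms and restriction of scalars *)

Section RestrictScalars.
Context {R : realType} {s : scalars}.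
Local Notation K := (scalar_field R s).

(** E as a real vector space, on which the Hahn-Banach theorem can be used. *)
Definition restrict_scalars (E : lmodType K) : Type := E.

Section Instances.
Context (E : lmodType K).

HB.instance Definition _ := GRing.Zmodule.on (restrict_scalars E).

Let scale (r : R) (x : restrict_scalars E) : restrict_scalars E :=
  (emb r : K) *: (x : E).

Let scaleA a b x : scale a (scale b x) = scale (a * b) x.
Proof. by rewrite /scale scalerA embM. Qed.
Let scale1 : left_id 1 scale.
Proof. by move=> x; rewrite /scale emb1 scale1r. Qed.
Let scaleDr : right_distributive scale +%R.
Proof. by move=> a x y; rewrite /scale scalerDr. Qed.
Let scaleDl x : {morph scale^~ x : a b / a + b}.
Proof. by move=> a b; rewrite /scale embD scalerDl. Qed.

HB.instance Definition _ := GRing.Zmodule_isLmodule.Build R (restrict_scalars E)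
  scaleA scale1 scaleDr scaleDl.

Lemma real_scaleE (r : R) (x : E) :
  r *: (x : restrict_scalars E) = (emb r : K) *: x :> E.
Proof. by []. Qed.

End Instances.

Definition seminorm {E : lmodType K} (q : E -> R) :=
  (forall x y, q (x + y) <= q x + q y) /\
  (forall (k : K) x, q (k *: x) = modulus k * q x).

Section SeminormTheory.
Context {E : lmodType K} (q : E -> R) (sq : seminorm q).

Lemma seminorm0 : q 0 = 0.
Proof. by rewrite -(scale0r (0 : E)) sq.2 modulus0 mul0r. Qed.

Lemma seminormN x : q (- x) = q x.
Proof. by rewrite -scaleN1r sq.2 modulusN modulus1 mul1r. Qed.

Lemma seminorm_ge0 x : 0 <= q x.
Proof.
have := sq.1 x (- x); rewrite subrr seminorm0 seminormN.
by rewrite -mulr2n pmulrn_lge0.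
Qed.

End SeminormTheory.

End RestrictScalars.

(** Over C the functional is phi x = f x - i f (i x), whose real part is f;
    both parts are dominated by q, since q (i x) = q x. *)
Lemma dominating_linear_functional (R : realType) (s : scalars)
    (E : lmodType (scalar_field R s)) (q f : E -> R) :
    seminorm q ->
    (forall x y, f (x + y) = f x + f y) ->
    (forall (a : R) x, f ((emb a : scalar_field R s) *: x) = a * f x) ->
    (forall x, `|f x| <= q x) ->
  exists phi : {linear E -> (scalar_field R s)^o}, forall x,
    `|f x| <= modulus (phi x) /\ modulus (phi x) <= 2 * q x.
Proof.
move=> sq fD fZ fq; have q0 := seminorm_ge0 sq.
case: s E q f sq fD fZ fq q0 => E q f sq fD fZ fq q0.
  have lin : linear (f : E -> R^o).
    by move=> a x y; rewrite fD; congr (_ + _); exact: fZ.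
  pose fR : E -> R^o := f.
  pose fL : {linear E -> R^o} :=
    HB.pack fR (GRing.isLinear.Build _ _ _ _ fR lin).
  exists fL => x /=; split => //; apply: le_trans (fq x) _.
  by rewrite ler_peMl // ler1n.
pose phi (x : E) : R[i]^o := (f x +i* - f ('i%C *: x))%C.
have lin : linear phi.
  move=> [a b] x y; rewrite /phi.
  have cE (u v : R) z : f ((u +i* v)%C *: z) = u * f z + v * f ('i%C *: z).
    rewrite -!fZ -fD; congr f; rewrite scalerA -scalerDl; congr (_ *: _).
    by apply/eqP; rewrite eq_complex /=; simpc; rewrite ?eqxx.
  rewrite scalerDr !fD (cE a b) scalerA.
  have -> : 'i%C * (a +i* b)%C = ((- b) +i* a)%C.
    by apply/eqP; rewrite eq_complex /=; simpc; rewrite ?eqxx.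
  rewrite (cE (- b) a); apply/eqP; rewrite eq_complex /=; apply/andP; split;
    apply/eqP => /=; ring.
pose phiL : {linear E -> R[i]^o} :=
  HB.pack phi (GRing.isLinear.Build _ _ _ _ phi lin).
exists phiL => x /=; split.
  rewrite -sqrtr_sqr ler_wsqrtr // lerDl; exact: sqr_ge0.
have -> : 2 * q x = q x + q ('i%C *: x).
  by rewrite sq.2 /= expr0n expr1n add0r sqrtr1 mul1r mulr_natl mulr2n.
have qq : 0 <= q x + q ('i%C *: x) by rewrite addr_ge0.
rewrite -[leRHS]ger0_norm // -sqrtr_sqr ler_wsqrtr //.
have := fq x; have := fq ('i%C *: x); have := q0 x; have := q0 ('i%C *: x).
move: (f x) (f _) (q x) (q _) => a b c d d0 c0 bd ac.
have ac2 : a ^+ 2 <= c ^+ 2 by rewrite -(real_normK (num_real a)) ler_pXn2r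
  ?nnegrE.
have bd2 : b ^+ 2 <= d ^+ 2 by rewrite -(real_normK (num_real b)) ler_pXn2r
  ?nnegrE.
by nra.
Qed.

(** * Seminorms of a locally convex space *)

Section LocallyConvex.
Context {R : realType} {s : scalars}.
Local Notation K := (scalar_field R s).
Context {E : tvsType K}.
Implicit Types (x y : E) (U V W : set E) (k : K).

Lemma nbhs0_translate x U : nbhs x U -> nbhs 0 [set y | U (x + y)].
Proof.
move=> xU; have := @add_continuous E (x, 0); rewrite /continuous_at /= addr0.
move=> /(_ U xU) [[A B] /= [xA B0] ABU]; apply: filterS B0 => y By.
by apply: (ABU (x, y)); split => //; exact: nbhs_singleton.
Qed.

Lemma nbhs_translate0 x U : nbhs 0 U -> nbhs x [set y | U (y - x)].
Proof.
move=> U0; have := @sub_continuous E (x, x); rewrite /continuous_at /= subrr.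
move=> /(_ U U0) [[A B] /= [xA xB] ABU]; apply: filterS xA => y Ay.
by apply: (ABU (y, x)); split => //; exact: nbhs_singleton.
Qed.

Lemma scale_nbhs0 k U : nbhs 0 U -> nbhs 0 [set x | U (k *: x)].
Proof.
move=> U0; have := @scale_continuous K E (k, 0);
  rewrite /continuous_at /= scaler0.
move=> /(_ U U0) [[A B] /= [kA B0] ABU]; apply: filterS B0 => y By.
by apply: (ABU (k, y)); split => //; exact: nbhs_singleton.
Qed.

Lemma small_scale_nbhs x U : nbhs 0 U ->
  exists e V, [/\ 0 < e, nbhs x V &
    forall (k : K) y, modulus k < e -> V y -> U (k *: y)].
Proof.
move=> U0; have := @scale_continuous K E (0, x);
  rewrite /continuous_at /= scale0r.
move=> /(_ U U0) [[A B] /= [+ xB] ABU] => /nbhs_scalarP [e e0 eA].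
exists e, B; split => // k y ke By; apply: (ABU (k, y)); split => //=.
by apply: eA; rewrite sub0r modulusN.
Qed.

Lemma convex_nbhs0 U : nbhs 0 U -> exists V, [/\ nbhs 0 V, V `<=` U &
  forall (t : R) x y, 0 <= t <= 1 -> V x -> V y ->
    V ((emb t : K) *: x + (emb (1 - t) : K) *: y)].
Proof.
have [B Bc [Bo Bb]] := @locally_convex K E; move=> U0.
have [V [BV V0] VU] := Bb 0 U U0.
exists V; split => //.
  by apply: open_nbhs_nbhs; split => //; exact: Bo.
move=> t x y /andP[t0 t1] Vx Vy.
have kI : (0 <= emb t :> K) && (emb t <= 1 :> K).
  by rewrite -emb0 -emb1 !ler_emb t0.
have := Bc V; rewrite inE => /(_ BV) /(_ x y (Itv01 (andP kI).1 (andP kI).2)).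
rewrite !inE => /(_ Vx Vy); rewrite embB emb1; exact.
Qed.

(** The seminorm is the gauge of the balanced core W of a convex neighbourhood;
    W is a neighbourhood of 0 because scaling is jointly continuous at (0, 0).
    *)
Lemma seminorm_basis U : nbhs 0 U -> exists q : E -> R,
  [/\ seminorm q, forall e, 0 < e -> nbhs 0 [set x | q x < e] &
      forall x, q x < 1 -> U x].
Proof.
move=> /convex_nbhs0 [V [V0 VU Vc]].
pose W : set E := [set x | forall k, modulus k <= 1 -> V (k *: x)].
have W0 : nbhs 0 W.
  have [e [V' [e0 V'0 eV]]] := small_scale_nbhs 0 V0.
  apply: filterS (scale_nbhs0 (emb (e / 2)^-1 : K) V'0) => x /= V'x k k1.
  have -> : k *: x = (k * emb (e / 2)) *: ((emb (e / 2)^-1 : K) *: x).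
    rewrite scalerA -mulrA -embM mulfV ?emb1 ?mulr1 //.
    by rewrite gt_eqF // divr_gt0.
  apply: eV => //; rewrite modulusM modulus_emb ger0_norm ?divr_ge0 // ?ltW //.
  have e2 : e / 2 < e by rewrite ltr_pdivrMr // ltr_pMr // ltr1n.
  by apply: le_lt_trans e2; rewrite ler_piMl // divr_ge0 // ltW.
have Wb k x : modulus k <= 1 -> W x -> W (k *: x).
  move=> k1 Wx l l1; rewrite scalerA; apply: Wx.
  by rewrite modulusM mulr_ile1 ?modulus_ge0.
have WV x : W x -> V x.
  by move=> /(_ 1); rewrite modulus1 scale1r; apply.
have Wc (t : R) x y : 0 <= t <= 1 -> W x -> W y ->
    W ((emb t : K) *: x + (emb (1 - t) : K) *: y).
  move=> t01 Wx Wy k k1; rewrite scalerDr !scalerA ![k * _]mulrC -!scalerA.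
  by apply: Vc => //; [exact: Wx|exact: Wy].
pose D x := [set t : R | 0 < t /\ W ((emb t^-1 : K) *: x)].
have Dn x : D x !=set0.
  have [e [V' [e0 /nbhs_singleton V'x eV]]] := small_scale_nbhs x W0.
  exists (2 / e); split; first by rewrite divr_gt0.
  apply: eV => //; rewrite modulus_emb invf_div ger0_norm ?divr_ge0 ?ltW //.
  by rewrite ltr_pdivrMr // ltr_pMr // ltr1n.
have Dlb x : has_lbound (D x) by exists 0 => t [/ltW].
pose q x := inf (D x).
have qle x t : D x t -> q x <= t by exact: ge_inf.
have leq x b : (forall t, D x t -> b <= t) -> b <= q x by exact: lb_le_inf.
have q0 : q 0 = 0.
  apply/eqP; rewrite eq_le; apply/andP; split; last by apply: leq => t [/ltW].
  apply/ler_addgt0Pr => e e0; rewrite add0r; apply: qle; split => //.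
  by rewrite scaler0; exact: nbhs_singleton.
have sq : seminorm q.
  split=> [x y|k x].
    rewrite -lerBlDr; apply: (leq) => t [t0 Wt].
    rewrite lerBlDr [leRHS]addrC -lerBlDr; apply: (leq) => u [u0 Wu].
    rewrite lerBlDr [leRHS]addrC; apply: qle; split; first by rewrite addr_gt0.
    have tu : t + u != 0 by rewrite gt_eqF // addr_gt0.
    have -> : (emb (t + u)^-1 : K) *: (x + y) =
       (emb (t / (t + u)) : K) *: ((emb t^-1 : K) *: x) +
       (emb (1 - t / (t + u)) : K) *: ((emb u^-1 : K) *: y).
      rewrite !scalerA -!embM scalerDr; congr (emb _ *: _ + emb _ *: _).
        by field; rewrite tu gt_eqF.
      by field; rewrite tu gt_eqF.
    apply: Wc => //; apply/andP; split; first by rewrite divr_ge0 // ltW //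
      addr_gt0.
    by rewrite ler_pdivrMr ?addr_gt0 // mul1r lerDl ltW.
  have qZ l y : l != 0 -> q (l *: y) <= modulus l * q y.
    move=> l0; have ml0 : 0 < modulus l.
      by rewrite lt_neqAle modulus_ge0 eq_sym modulus_eq0 l0.
    rewrite -ler_pdivrMl //; apply: (leq) => t [t0 Wt].
    rewrite ler_pdivrMl //; apply: qle; split; first by rewrite mulr_gt0.
    have -> : (emb (modulus l * t)^-1 : K) *: (l *: y) =
       ((emb (modulus l))^-1 * l) *: ((emb t^-1 : K) *: y).
      rewrite !scalerA; congr (_ *: _); rewrite invfM embM !embV.
      by rewrite mulrAC.
    apply: Wb => //; rewrite modulusM modulusV modulus_emb ger0_norm
      ?modulus_ge0 //.
    by rewrite mulVf ?gt_eqF.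
  have [->|k0] := eqVneq k 0; first by rewrite scale0r modulus0 mul0r.
  have mk0 : 0 < modulus k.
    by rewrite lt_neqAle modulus_ge0 eq_sym modulus_eq0 k0.
  apply/eqP; rewrite eq_le qZ //= -ler_pdivlMl //.
  rewrite -{1}[x]scale1r -(mulVf k0) -scalerA -modulusV.
  by apply: qZ; rewrite invr_eq0.
exists q; split => // [e e0|x].
  apply: filterS (scale_nbhs0 (emb (e / 2)^-1 : K) W0) => x Wx /=.
  have e2 : e / 2 < e by rewrite ltr_pdivrMr // ltr_pMr // ltr1n.
  by apply: le_lt_trans e2; apply: qle; split => //; rewrite divr_gt0.
move=> /inf_lt [] // t [t0 Wt] t1; apply: VU.
have -> : x = (emb t : K) *: ((emb t^-1 : K) *: x).
  by rewrite scalerA -embM mulfV ?gt_eqF // emb1 scale1r.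
by apply: Wt; rewrite modulus_emb gtr0_norm // ltW.
Qed.

Definition continuous_seminorm (q : E -> R) :=
  seminorm q /\ forall e, 0 < e -> nbhs 0 [set x | q x < e].

Lemma bounded_linear_continuous (q : E -> R) (M : R) (phi : {linear E -> K^o}) :
  continuous_seminorm q -> (forall x, modulus (phi x : K) <= M * q x) ->
  continuous phi.
Proof.
move=> [sq cq] phiq x A /nbhs_scalarP [e e0 eA].
have M0 : 0 < `|M| + 1 by rewrite ltr_wpDl.
apply: filterS (nbhs_translate0 x (cq (e / (`|M| + 1)) _)); last first.
  by rewrite divr_gt0.
move=> y /=; rewrite ltr_pdivlMr // => qe; apply: eA.
rewrite -linearB -opprB linearN modulusN.
apply: le_lt_trans (phiq _) _; apply: le_lt_trans qe.
rewrite mulrC ler_wpM2l ?(seminorm_ge0 sq) //.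
by rewrite (le_trans (ler_norm _)) // lerDl.
Qed.

Lemma continuous_functional_bound (phi : {linear E -> K^o}) : continuous phi ->
  nbhs 0 [set x | modulus (phi x : K) < 1].
Proof.
move=> cphi; apply: (cphi 0 [set k : K^o | modulus (k : K) < 1]).
by apply/nbhs_scalarP; exists 1 => // y; rewrite linear0 sub0r modulusN.
Qed.

Lemma lc_boundedP (A : set E) :
  lc_bounded A <->
  forall q, continuous_seminorm q -> exists M, forall x, A x -> q x <= M.
Proof.
split=> [bA q [sq cq]|bA U U0].
  have [r r0 Ar] := bA _ (cq 1 ltr01).
  exists (modulus r) => x /Ar [y /= qy <-]; rewrite sq.2 ler_piMr ?modulus_ge0
    //.
  exact: ltW.
have [q [sq cq qU]] := seminorm_basis U0.
have [M AM] := bA q (conj sq cq).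
have M0 : 0 < `|M| + 1 by rewrite ltr_wpDl.
exists (emb (`|M| + 1)); first by rewrite -emb0 ltr_emb.
move=> x Ax; exists ((emb (`|M| + 1)^-1 : K) *: x); last first.
  by rewrite scalerA -embM mulfV ?gt_eqF // emb1 scale1r.
apply: qU; rewrite sq.2 modulus_emb ger0_norm ?invr_ge0 ?ltW //.
rewrite mulrC ltr_pdivrMr // mul1r (le_lt_trans (AM _ Ax)) //.
by rewrite (le_lt_trans (ler_norm _)) // ltrDl.
Qed.

End LocallyConvex.

(** * Weakly bounded sets are bounded *)

Section WeaklyBounded.
Context {R : realType} {s : scalars}.
Local Notation K := (scalar_field R s).
Context {E : tvsType K}.

Lemma norming_functional (q : E -> R) u : seminorm q -> exists f : E -> R,
  [/\ forall x y, f (x + y) = f x + f y,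
      forall (a : R) x, f ((emb a : K) *: x) = a * f x,
      forall x, `|f x| <= q x & f u = q u].
Proof.
move=> sq; have subq : sublinear (q : restrict_scalars E -> R).
  split; first exact: sq.1.
  by move=> a x a0; rewrite real_scaleE sq.2 modulus_emb gtr0_norm.
have [f [fD fZ fq fu]] := @Hahn_Banach_support R (restrict_scalars E) q u subq.
exists f; split => // x.
rewrite ler_norml fq andbT lerNl -(seminormN sq).
by have := fZ (- 1) x; rewrite scaleN1r mulN1r => <-.
Qed.

Lemma lim_dist_le (u : R^nat) (a b : R) (N : nat) : cvgn u ->
  (forall n, (N <= n)%N -> `|u n - a| <= b) -> `|limn u - a| <= b.
Proof.
move=> cu ub; have cn : `|u n - a| @[n --> \oo] --> `|limn u - a|.
  exact: (cvg_norm (cvgB cu (cvg_cst a))).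
by apply: (cvgr_to_le cn); exists N.
Qed.

(** If a continuous seminorm q is unbounded on B, choose x_k in B with q x_k
    large and f_k dominated by q with f_k x_k = q x_k. With suitable signs the
    partial sum of sum_k +-3^-k f_k that ends at k has absolute value at least
    3^-k q x_k at x_k, and the tail can take back at most half of that. The sum
    is thus dominated by a continuous functional that is unbounded on B. *)
Lemma weakly_bounded_bounded (B : set E) :
  (forall phi : {linear E -> K^o}, continuous phi ->
    exists M, forall x, B x -> modulus (phi x : K) <= M) ->
  lc_bounded B.
Proof.
move=> wB; apply/lc_boundedP => q cq; apply: contrapT => nB.
have [sq _] := cq; have q0 := seminorm_ge0 sq.
have big M : exists x, B x /\ M < q x.
  apply: contrapT => nx; apply: nB; exists M => x Bx; rewrite leNgt.
  by apply/negP => Mq; apply: nx; exists x.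
have [x xB] := choice (fun k : nat => big (3 ^+ k * (2 * k.+1%:R))).
have [f fP] := choice (fun k => norming_functional (x k) sq).
(* The sign of the n-th term is that of the partial sum before it at x_n. *)
pose c k : R := 3^-1 ^+ k.
have c0 k : 0 < c k by rewrite exprn_gt0.
pose G := fix G n : E -> R := if n is k.+1 then
   fun y => G k y + (if 0 <= G k (x k) then 1 else -1) * c k * f k y
  else fun=> 0.
pose sg k : R := if 0 <= G k (x k) then 1 else -1.
have sgN k : `|sg k| = 1 by rewrite /sg; case: ifP; rewrite ?normrN normr1.
have GS n y : G n.+1 y = G n y + sg n * c n * f n y by [].
have uN k y : `|sg k * c k * f k y| <= c k * q y.
  rewrite !normrM sgN mul1r gtr0_norm // ler_pM2l //.
  by have [_ _ + _] := fP k; apply.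
have Gseries y : G ^~ y = series (fun k => sg k * c k * f k y).
  apply/funext; elim => [|n IH]; first by rewrite /series /= big_geq.
  by rewrite GS IH /series /= big_nat_recr.
have cG y : cvgn (G ^~ y).
  rewrite Gseries; apply: normed_cvg; apply: (@series_le_cvg _ _ (fun n =>
    c n * q y)).
  - by move=> n; exact: normr_ge0.
  - by move=> n; rewrite mulr_ge0 // ltW.
  - by move=> n; exact: uN.
  rewrite (_ : (fun n => c n * q y) = geometric (q y) 3^-1).
    by apply: is_cvg_geometric_series; rewrite ger0_norm // invf_lt1 // ltr1n.
  by apply/funext => n; rewrite /geometric /= mulrC.
(* The sum of 3^-k for n <= k < m is 3 / 2 * (3^-n - 3^-m). *)
have tail n m y : (n <= m)%N -> `|G m y - G n y| <= 3 / 2 * (c n - c m) * q y.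
  move=> /subnK <-; elim: (m - n)%N => [|k IH].
    by rewrite add0n !subrr normr0 mulr0 mul0r.
  rewrite addSn GS addrAC (le_trans (ler_normD _ _)) //.
  apply: le_trans (lerD IH (uN _ _)) _.
  rewrite -mulrDl ler_wpM2r //.
  have -> : c (k + n).+1 = c (k + n)%N / 3 by rewrite /c exprSr.
  have := c0 (k + n)%N; lra.
pose g y : R := limn (G ^~ y).
have gtail n y : `|g y - G n y| <= 3 / 2 * c n * q y.
  apply: (@lim_dist_le _ _ _ n) => // m nm; apply: le_trans (tail n m y nm) _.
  rewrite ler_wpM2r // ler_wpM2l // ?divr_ge0 // lerBlDr lerDl;
    exact: ltW (c0 m).
have GD n y z : G n (y + z) = G n y + G n z.
  elim: n => [|n IH]; first by rewrite /= addr0.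
  by rewrite !GS IH; have [-> _ _ _] := fP n; rewrite mulrDr addrACA.
have GZ n (a : R) y : G n ((emb a : K) *: y) = a * G n y.
  elim: n => [|n IH]; first by rewrite /= mulr0.
  by rewrite !GS IH; have [_ -> _ _] := fP n; rewrite mulrDr (mulrCA a).
have gD y z : g (y + z) = g y + g z.
  rewrite /g -limD //; congr (limn _); apply/funext => n /=; exact: GD.
have gZ (a : R) y : g ((emb a : K) *: y) = a * g y.
  apply: cvg_lim => //.
  rewrite (_ : G ^~ _ = fun n => a * G n y); last by apply/funext => n;
    exact: GZ.
  by apply: cvgMl_tmp; exact: cG.
have gq y : `|g y| <= 2 * q y.
  have := gtail 0%N y; rewrite /c expr0 mulr1 /= subr0 => /le_trans -> //.
  by rewrite ler_wpM2r //; lra.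
have s2q : seminorm (fun y => 2 * q y).
  split=> [y z|k y]; first by rewrite -mulrDr ler_pM2l // sq.1.
  by rewrite sq.2 mulrCA.
have [phi phiP] := dominating_linear_functional s2q gD gZ gq.
have cphi : continuous phi.
  apply: (@bounded_linear_continuous _ _ _ q 4) => // y.
  by apply: le_trans (phiP y).2 _; rewrite mulrA -natrM.
have [M phiM] := wB phi cphi.
have [k Mk] : exists k : nat, M < k%:R.
  by exists (Num.truncn `|M|).+1; rewrite (le_lt_trans (ler_norm _)) //
    truncnS_gt.
have [Bk qk] := xB k.
have := phiM _ Bk; rewrite leNgt => /negP; apply.
apply: lt_le_trans (phiP _).1; apply: (lt_trans Mk).
have Gk : c k * q (x k) <= `|G k.+1 (x k)|.
  have [_ _ _ fk] := fP k; rewrite GS fk /sg; case: ifPn => Gk0.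
    by rewrite mul1r (le_trans _ (ler_norm _)) // lerDr.
  rewrite mulN1r mulNr -[leRHS]normrN opprB (le_trans _ (ler_norm _)) //.
  by rewrite lerDl oppr_ge0 ltW // ltNge.
have := gtail k.+1 (x k); rewrite [c k.+1]exprS -/(c k) => gk.
have gk2 : `|G k.+1 (x k)| <= `|g (x k)| + `|g (x k) - G k.+1 (x k)|.
  by rewrite -[in leLHS](subKr (g (x k)) (G k.+1 (x k))) ler_normB.
have : k.+1%:R * 2 < c k * q (x k).
  by rewrite /c exprVn -ltr_pdivrMl ?invr_gt0 ?exprn_gt0 // invrK [k.+1%:R *
    2]mulrC.
rewrite -natr1; move: gk gk2 Gk; rewrite -!mulrA.
set a := `|_ - _|; set b := `|g _|; set d := c k * q (x k).
set h := `|G _ _|; lra.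
Qed.

End WeaklyBounded.

(** * Supports of weakly bounded subsets of L(X) *)

Section Supports.
Context {R : realType} {s : scalars} {X : topologicalType}.
Local Notation K := (scalar_field R s).
Local Notation C := (continuousType X K^o).

Lemma functionally_boundedP (A : set X) : functionally_bounded K A <->
  forall f : C, exists M : R, forall x, A x -> modulus (f x : K) <= M.
Proof.
split=> fbA f.
  have [M [Mr fM]] := fbA f; exists (modulus M + 1) => x Ax.
  rewrite -(@ler_emb R s) -normr_modulus; apply: fM Ax.
  rewrite embD emb1 -normr_modulus.
  by rewrite (le_lt_trans (real_ler_norm Mr)) // ltrDl.
have [M fM] := fbA f; exists (emb M); split.
  by rewrite realE -emb0 !ler_emb -realE num_real.
move=> k Mk x Ax; apply: le_trans (ltW Mk).
by rewrite /= normr_modulus ler_emb; exact: fM.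
Qed.

(** Boundedness for the weak topology of the duality (L(X), C(X)). *)
Definition weakly_bounded (B : set (L X K)) :=
  forall f : C, exists M : R, forall l, B l -> modulus (pairing l f) <= M.

Lemma fset_modulus_bound (D : {fset X}) (f : X -> K) :
  exists M : R, forall x, x \in D -> modulus (f x) <= M.
Proof.
exists (\sum_(x <- D) modulus (f x)) => x xD.
by rewrite (big_fsetD1 x) //= lerDl sumr_ge0 // => y _; exact: modulus_ge0.
Qed.

Context (tX : tychonoff_space X).

(** If f is unbounded on the supports, there are l_n in B and x_n in supp l_n
    such that |f x_n| exceeds t_n, a bound for |f| on the earlier supports,
    with t_n tending to infinity. Bumps h_n at x_n that vanish where |f| <= t_n
    form a locally finite family, h_n is not seen by l_m for m < n, and the
    coefficients of g = sum_n c_n h_n can be chosen one after the other so that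
    l_n takes the value n at g, against weak boundedness. *)
Lemma supports_functionally_bounded (B : set (L X K)) : weakly_bounded B ->
  functionally_bounded K [set x | exists2 l, B l & x \in msupp l].
Proof.
move=> wB; apply/functionally_boundedP => f; apply: contrapT => nf.
pose a x : R := modulus (f x : K).
have ac : continuous a.
  move=> y; apply: (@continuous_comp X K^o R f modulus); first exact: cts_fun.
  exact: modulus_continuous.
have big (t : R) : exists z : L X K * X, [/\ B z.1,
  z.2 \in msupp z.1 & t < a z.2].
  apply: contrapT => nz; apply: nf; exists t => x [l Bl xl]; rewrite leNgt.
  by apply/negP => ta; apply: nz; exists (l, x).
have [z zP] := choice big.
have [b bP] := choice (fun l : L X K => fset_modulus_bound (msupp l) f).
pose t := fix t n : R := if n is k.+1 then t k + `|b (z (t k)).1| + 1 else 0.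
pose l n := (z (t n)).1; pose x n := (z (t n)).2.
have tS n : t n.+1 = t n + `|b (l n)| + 1 by [].
have t_le m n : (m <= n)%N -> t m <= t n.
  move=> /subnK <-; elim: (n - m)%N => // k IH; rewrite addSn tS -addrA.
  by rewrite (le_trans IH) // lerDl addr_ge0.
have t_nat n : n%:R <= t n.
  elim: n => [//|n IH]; rewrite tS -natr1 lerD2r (le_trans IH) // lerDl.
  exact: normr_ge0.
have al m n y : (m < n)%N -> y \in msupp (l m) -> a y <= t n.
  move=> mn /(bP (l m)) ay; apply: le_trans (t_le _ _ mn).
  rewrite tS (le_trans ay) // (le_trans (ler_norm _)) //.
  rewrite -addrA addrCA lerDl addr_ge0 //.
  by rewrite (le_trans _ (t_nat m)).
have bump n : exists h : C, [/\ h (x n) = 1, forall y, a y <= t n -> h y = 0 &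
    forall y, y \in msupp (l n) -> y <> x n -> h y = 0].
  pose Z := [set y | a y <= t n] `|` [set y | y \in (msupp (l n) `\ x n)%fset].
  have [||h [h1 h0]] := @separating_function R s X tX (x n) Z.
  - apply: closedU; last exact: fset_closed.
    apply: (@closed_comp X R a [set r | r <= t n]); last exact: closed_le.
    by move=> y _; exact: ac.
  - have [_ _ tx] := zP (t n).
    by case => /=; rewrite ?fsetD11 // leNgt tx.
  exists h; split => // [y ay|y yl /eqP yx]; apply: h0; first by left.
  by right; rewrite /= !inE yx.
have [h hP] := choice bump.
(* The coefficient that brings the pairing of l_n with g + coef * h_n to n. *)
pose coef n (g : C) : K := (n%:R - pairing (l n) g) / (l n)@_(x n).
pose G := fix G n : C := if n is k.+1 then G k + coef k (G k) *: h k else 0.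
have GS n : G n.+1 = G n + coef n (G n) *: h n by [].
have Gstab m n y : (m <= n)%N -> a y <= t m -> G n y = G m y.
  move=> /subnK <- ay; elim: (n - m)%N => // k IH.
  rewrite addSn GS ctsDE ctsZE IH.
  have [_ h0 _] := hP (k + m)%N; rewrite h0 ?scaler0 ?addr0 //.
  by rewrite (le_trans ay) // t_le // leq_addl.
(* As n <= t n, near y the sum g is its partial sum up to N y. *)
pose N y := (Num.truncn (a y)).+1.
have aN y : a y < (N y)%:R by exact: truncnS_gt.
pose g y : K^o := G (N y) y.
have gG n y : a y <= t n -> g y = G n y.
  move=> ayn; rewrite /g; have ayN : a y <= t (N y).
    by rewrite (le_trans (ltW (aN y))).
  by have [/Gstab|/ltnW/Gstab] := leqP (N y) n => ->.
have gc : continuous g.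
  move=> y; have nbg : \forall w \near y, G (N y) w = g w.
    have : nbhs y (a @^-1` [set r | r < (N y)%:R]).
      by apply: open_nbhs_nbhs; split; [apply: open_comp => [w _|];
        [exact: ac|exact: open_lt]|exact: aN].
    apply: filterS => w aw; rewrite (gG (N y)) // (le_trans (ltW aw)) //.
  apply: (cvg_trans (near_eq_cvg nbg)).
  by rewrite /g; exact: cts_fun.
pose gC : C := mkcts gc.
have [M gM] := wB gC.
have val n : pairing (l n) gC = n%:R.
  have -> : pairing (l n) gC = pairing (l n) (G n.+1).
    apply: eq_big_seq => y yl; congr (_ * _); rewrite [LHS](_ : _ = g y) //.
    by apply: gG; exact: (al n).
  rewrite GS pairingDr pairingZr.
  have [h1 _ h0] := hP n; have [_ xl _] := zP (t n).
  rewrite (pairing_single h0) h1 mulr1 /coef divfK; last by rewrite mcoeff_neq0.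
  by rewrite addrC subrK.
pose n := (Num.truncn `|M|).+1.
have [Bl _ _] := zP (t n).
have := gM _ Bl; rewrite -/(l n) val leNgt => /negP; apply.
have -> : n%:R = emb n%:R :> K.
  by elim: n {Bl} => [|n IH]; rewrite ?emb0 // -!natr1 embD emb1 IH.
rewrite modulus_emb ger0_norm //.
by rewrite (le_lt_trans (ler_norm _)) // truncnS_gt.
Qed.

End Supports.

(** * Neighbourhoods and dual of C_p(X) *)

Section CpTheory.
Context {R : realType} {s : scalars} {X : topologicalType}.
Local Notation K := (scalar_field R s).
Local Notation C := (continuousType X K^o).
Local Notation Cp := (Cp X K).
Implicit Types (f g : Cp) (x y : X) (D : {fset X}).

(** The sets on the right generate a filter that converges to 0 pointwise,
    hence in C_p(X). *)
Lemma Cp_nbhs0 (U : set Cp) : nbhs 0 U -> exists D (e : R), 0 < e /\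
  forall f, (forall x, x \in D -> modulus (Cp_eval x f : K) < e) -> U f.
Proof.
move=> U0.
pose I := [set De : {fset X} * R | 0 < De.2].
pose V (De : {fset X} * R) : set Cp :=
  [set f | forall x, x \in De.1 -> modulus (Cp_eval x f : K) < De.2].
have FV : Filter (filter_from I V).
  apply: filter_from_filter; first by exists (fset0, 1); rewrite /I /=.
  move=> [D1 e1] [D2 e2] /= e10 e20.
  exists ((D1 `|` D2)%fset, Num.min e1 e2); first by rewrite /I /= lt_min e10.
  move=> f Vf; split => x /= xD.
    by have := Vf x; rewrite /= inE xD lt_min => /(_ isT) /andP[].
  by have := Vf x; rewrite /= inE xD orbT lt_min => /(_ isT) /andP[].
have : filter_from I V --> (0 : Cp).
  apply/cvg_CpP => x A /nbhs_scalarP [e e0 eA].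
  exists ([fset x]%fset, e) => //= f Vf; apply: eA.
  by rewrite [Cp_eval x 0](_ : _ = 0) // sub0r modulusN; apply: Vf; rewrite inE.
move=> /(_ U U0) [[D e] /= e0 VU]; by exists D, e.
Qed.

Lemma ctsE_sum (I : Type) (r : seq I) (F : I -> C) x :
  (\sum_(i <- r) F i) x = \sum_(i <- r) F i x.
Proof. exact: (big_morph (fun f : C => f x) (fun f g =>
  ctsDE f g x) (cts0E x)). Qed.

Lemma eventually0_cvg (h : nat -> Cp) :
  (forall x, exists N, forall n, (N <= n)%N -> Cp_eval x (h n) = 0) ->
  h @ \oo --> (0 : Cp).
Proof.
move=> h0; apply/cvg_CpP => x; apply: cvg_near_cst.
by have [N hN] := h0 x; exists N.
Qed.

Context (tX : tychonoff_space X).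

(** chi is bounded on the functions that are small on some finite set D, so it
    vanishes on those that are zero on D, and depends only on the values on D.
    *)
Lemma Cp_dual_pairing (chi : dual Cp) : exists l : L X K,
  forall f, chi f = pairing l (f : C).
Proof.
have [D [e [e0 De]]] := Cp_nbhs0 (continuous_functional_bound (@dual_continuous
  _ _ chi)).
have van f : (forall x, x \in D -> Cp_eval x f = 0) -> chi f = 0.
  move=> f0; apply/eqP; apply: contrapT => /negP cf0.
  (* A multiple of f at which chi is 2 violates the bound by 1. *)
  have cf2 : chi ((2 / chi f) *: f) = 2 by rewrite linearZ; exact: (divfK cf0).
  have := De ((2 / chi f) *: f); rewrite /mkset cf2.
  have -> : 2 = emb 2 :> K by rewrite embD emb1.
  rewrite modulus_emb ger0_norm // ltNge ler1n => small.
  suff : ~~ true by []; apply: small.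
  move=> x xD; rewrite -[modulus _]/(modulus ((emb 2 / chi f) * Cp_eval x f :
    K)).
  by rewrite f0 // mulr0 modulus0.
have [c cP] := choice (fun x => @coordinate_function R s X tX D x).
exists (\sum_(x <- D) chi (c x) *: (<< x >> : L X K)) => f.
have -> : chi f = chi (\sum_(x <- D) Cp_eval x f *: (c x : Cp)).
  apply/eqP; rewrite -subr_eq0 -linearB; apply/eqP; apply: van => y yD.
  have -> : Cp_eval y (f - \sum_(x <- D) Cp_eval x f *: (c x : Cp)) =
      (f : C) y - (\sum_(x <- D) Cp_eval x f *: (c x : C)) y by [].
  rewrite ctsE_sum (big_fsetD1 y) //= big1_fset.
    by rewrite addr0 ctsZE (cP y).1 /GRing.scale /= mulr1 subrr.
  move=> x; rewrite !inE => /andP[/eqP xy xD] _.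
  by rewrite ctsZE (cP x).2 ?scaler0 // => yx; apply: xy.
rewrite linear_sum pairing_suml; apply: eq_bigr => x _.
by rewrite linearZ pairingZl pairing_dirac mulrC.
Qed.

End CpTheory.

(** * The sequence spaces l_p and c_0 *)

Section Ell.
Context {R : realType}.
Implicit Types (p q : \bar R) (a b : R^nat).

Lemma ge1_ereal_ind (P : \bar R -> Prop) :
  (forall r, 1 <= r -> P r%:E) -> P +oo%E -> forall p, (1 <= p)%E -> P p.
Proof. by move=> Pr Py [r||] p1; [apply: Pr; rewrite -lee_fin|exact: Py|]. Qed.

Lemma ell_dominated p a b : (1 <= p)%E ->
  (forall n, `|a n| <= `|b n|) -> ell p b -> ell p a.
Proof.
move: p; apply: ge1_ereal_ind => [r r1 ab|ab b0].
  apply: series_le_cvg => n; rewrite ?powR_ge0 //.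
  apply: ge0_ler_powR; rewrite ?nnegrE ?normr_ge0 //; exact: le_trans r1.
apply/cvgr0Pnorm_lt => e e0.
move/cvgr0Pnorm_lt/(_ e e0): b0; apply: filterS => n.
exact: le_lt_trans.
Qed.

(** (u + v)^r <= (2 max u v)^r <= 2^r (u^r + v^r). *)
Lemma ellD p a b : (1 <= p)%E -> (forall n, 0 <= a n) -> (forall n, 0 <= b n) ->
  ell p a -> ell p b -> ell p (fun n => a n + b n).
Proof.
move=> p1 a0 b0; move: p p1; apply: ge1_ereal_ind => [r r1|]; last first.
  by move=> ca cb; rewrite /= -[0]addr0; exact: cvgD.
move=> ca cb.
have r0 : 0 <= r by apply: le_trans r1.
have cab := @is_cvg_seriesZ _ _ (2 `^ r) (is_cvg_seriesD ca cb).
apply: series_le_cvg cab => n; rewrite ?powR_ge0 //.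
  by rewrite /= mulr_ge0 ?addr_ge0 ?powR_ge0.
rewrite !ger0_norm ?addr_ge0 //.
rewrite [leRHS](_ : _ = 2 `^ r * (a n `^ r + b n `^ r)); last first.
  by rewrite -[LHS]/(2 `^ r * (`|a n| `^ r + `|b n| `^ r)) !ger0_norm.
have powD (u v : R) : 0 <= u -> u <= v -> (u + v) `^ r <= 2 `^ r * (u `^ r + v
  `^ r).
  move=> u0 uv; have v0 := le_trans u0 uv.
  apply: (@le_trans _ _ ((2 * v) `^ r)).
    apply: ge0_ler_powR; rewrite ?nnegrE ?addr_ge0 ?mulr_ge0 //.
    by rewrite mulr_natl mulr2n lerD2r.
  by rewrite powRM // ler_wpM2l ?powR_ge0 // lerDr powR_ge0.
have [ab|ba] := leP (a n) (b n); first exact: powD.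
by rewrite addrC [a n `^ r + _]addrC powD // ltW.
Qed.

Lemma ellZ p (c : R) a : (1 <= p)%E -> ell p a -> ell p (fun n => c * a n).
Proof.
move: p; apply: ge1_ereal_ind => [r r1|]; last first.
  by move=> ca; rewrite /= -(mulr0 c); exact: cvgMl_tmp.
move=> ca; rewrite /= (_ : (fun n => `|c * a n| `^ r) = `|c| `^ r *: (fun n =>
  `|a n| `^ r)).
  exact: is_cvg_seriesZ.
by apply/funext => n; rewrite normrM powRM.
Qed.

Lemma ell_sum p (I : eqType) (D : seq I) (F : I -> R^nat) : (1 <= p)%E ->
  (forall i n, 0 <= F i n) -> (forall i, i \in D -> ell p (F i)) ->
  ell p (fun n => \sum_(i <- D) F i n).
Proof.
move=> p1 F0; elim: D => [|i D IH] FD.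
  have -> : (fun n => \sum_(i <- [::]) F i n) = (fun=> 0).
    by apply/funext => n; rewrite big_nil.
  move: {FD} p p1; apply: ge1_ereal_ind => [r r1|]; last exact: cvg_cst.
  rewrite /= normr0 powR0; last by rewrite gt_eqF // (lt_le_trans ltr01).
  rewrite (_ : series _ = fun=> 0); first exact: is_cvg_cst.
  by apply/funext => n; rewrite /series /= big1.
have -> : (fun n => \sum_(j <- i :: D) F j n) =
    (fun n => F i n + \sum_(j <- D) F j n).
  by apply/funext => n; rewrite big_cons.
apply: ellD => //.
- by move=> n; apply: sumr_ge0 => j _.
- by apply: FD; rewrite mem_head.
- by apply: IH => j jD; apply: FD; rewrite inE jD orbT.
Qed.

Lemma ell_cvg0 p a : (1 <= p)%E -> ell p a -> a @ \oo --> 0.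
Proof.
move: p; apply: ge1_ereal_ind => [r r1|//] /cvg_series_cvg_0 c0.
have r0 : 0 < r by apply: lt_le_trans r1.
apply/cvgr0Pnorm_lt => e e0; have er0 : 0 < e `^ r by rewrite powR_gt0.
move/cvgr0Pnorm_lt/(_ _ er0): c0; apply: filterS => n.
rewrite ger0_norm ?powR_ge0 //; apply: contraTT; rewrite -!leNgt => ea.
by apply: (ge0_ler_powR (ltW r0)) => //; rewrite ?nnegrE // ltW.
Qed.

Lemma ell_bounded p a : (1 <= p)%E -> ell p a -> exists M, forall n,
  `|a n| <= M.
Proof.
move=> p1 /(ell_cvg0 p1) ca.
have [M [_ aM]] := cvg_seq_bounded (cvgP _ ca).
exists (M + 1) => n; apply: (aM (M + 1)); rewrite ?ltrDl //.
Qed.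

(** A sequence in l_p is bounded by some M, whence |a|^q <= M^(q - p) |a|^p for
    finite q. *)
Lemma ell_le p q a : (1 <= p)%E -> (p <= q)%E -> ell p a -> ell q a.
Proof.
move=> p1; move: p p1; apply: ge1_ereal_ind => [r r1|]; last first.
  by rewrite leye_eq => /eqP ->.
have r1E : (1 <= r%:E)%E by rewrite lee_fin.
case: q => [t| |]; last by [].
  rewrite lee_fin => rt ca.
  have [M aM] := ell_bounded r1E ca.
  move: ca => /= ca.
  have ca' := @is_cvg_seriesZ _ _ (M `^ (t - r)) ca.
  apply: series_le_cvg ca' => n; rewrite ?powR_ge0 //.
    by rewrite /= mulr_ge0 ?powR_ge0.
  rewrite -[leRHS]/(M `^ (t - r) * `|a n| `^ r).
  have -> : `|a n| `^ t = `|a n| `^ (t - r) * `|a n| `^ r.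
    rewrite -powRD ?subrK // gt_eqF //.
    by rewrite (lt_le_trans ltr01) // (le_trans r1).
  rewrite ler_wpM2r ?powR_ge0 //; apply: ge0_ler_powR;
    rewrite ?nnegrE ?subr_ge0 //.
  exact: le_trans (aM n).
by move=> _ /(ell_cvg0 r1E).
Qed.

Lemma ell_geometric p a (M : R) : (1 <= p)%E ->
  (forall n, `|a n| <= M * 2^-1 ^+ n) -> ell p a.
Proof.
move=> p1 aM; suff : ell 1%E a by apply: ell_le; rewrite ?lexx.
rewrite /=; apply: (@series_le_cvg _ _ (geometric M 2^-1)) => [n|n|n|].
- exact: powR_ge0.
- exact: le_trans (aM n).
- by rewrite powRr1 //; exact: aM.
by apply: is_cvg_geometric_series; rewrite ger0_norm // invf_lt1 // ltr1n.
Qed.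

End Ell.

(** * C_p(X) with an infinite functionally bounded subset of X *)

Section NullSequences.
Context {R : realType} {s : scalars}.
Local Notation K := (scalar_field R s).
Context {E : tvsType K}.

Lemma null_sequence_totally_bounded (h : nat -> E) :
  h @ \oo --> (0 : E) -> totally_bounded (range h).
Proof.
move=> h0 U U0; have [N _ hN] := h0 U U0.
exists (0 |` [set h n | n in `I_N]).
  rewrite finite_setU; split; first exact: finite_set1.
  exact/finite_image/finite_II.
move=> _ [n _ <-]; have [Nn|nN] := leqP N n.
  exists 0; first by left.
  by exists (h n); [exact: hN|rewrite add0r].
exists (h n); first by right; exists n.
by exists 0; [exact: nbhs_singleton|rewrite addr0].
Qed.

Lemma eventually_bounded (h : nat -> E) :
  (forall q, continuous_seminorm q ->
    exists N M, forall n, (N <= n)%N -> q (h n) <= M) ->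
  lc_bounded (range h).
Proof.
move=> hb; apply/lc_boundedP => q cq; have [N [M hM]] := hb q cq.
have q0 := seminorm_ge0 cq.1.
exists (`|M| + \sum_(i < N) q (h i)) => _ [n _ <-].
have [Nn|nN] := leqP N n.
  rewrite (le_trans (hM n Nn)) // (le_trans (ler_norm _)) //.
  by rewrite lerDl sumr_ge0.
by rewrite (bigD1 (Ordinal nN)) //= addrCA lerDl addr_ge0 // sumr_ge0.
Qed.

Lemma null_sequence_bounded (h : nat -> E) :
  h @ \oo --> (0 : E) -> lc_bounded (range h).
Proof.
move=> h0; apply: eventually_bounded => q [sq cq].
have [N _ hN] := h0 _ (cq 1 ltr01).
by exists N, 1 => n /hN /ltW.
Qed.

Lemma cauchy_sequence_bounded (h : nat -> E) :
  lc_cauchy (h @ \oo) -> lc_bounded (range h).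
Proof.
move=> hc; apply: eventually_bounded => q [sq cq].
have [B [N _ NB] BB] := hc _ (cq 1 ltr01).
exists N, (1 + q (h N)) => n Nn; rewrite -[h n](subrK (h N)).
rewrite (le_trans (sq.1 _ _)) // lerD2r ltW //.
by apply: BB; apply: NB => /=.
Qed.

End NullSequences.

Section CpNegative.
Context {R : realType} {s : scalars} {X : topologicalType}.
Local Notation K := (scalar_field R s).
Local Notation C := (continuousType X K^o).
Local Notation Cp := (Cp X K).
Context (tX : tychonoff_space X).

Lemma scaled_evaluation (c : K) x : exists chi : dual Cp,
  forall f, chi f = c * Cp_eval x f.
Proof.
pose ev (f : Cp) : K^o := c * Cp_eval x f.
have lin : linear ev.
  move=> k f g; rewrite /ev.
  rewrite -[Cp_eval x _]/(k * Cp_eval x f + Cp_eval x g) mulrDr.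
  by rewrite mulrCA.
pose evL : {linear Cp -> K^o} := HB.pack ev (GRing.isLinear.Build _ _ _ _ ev
  lin).
have evc : continuous evL.
  move=> f; have := @Cp_eval_continuous X K x f.
  exact: (@cvgMl_tmp K Cp (nbhs f) _ (Cp_eval x) c (Cp_eval x f)).
by exists (Dual evc).
Qed.

(** Take chi_n = 2^-n delta_{x_n} and h_n = 2^n g_n with x_n in A and g_n bumps
    at x_n with disjoint supports: each point lies in at most one support, so
    h_n tends to 0 pointwise. *)
Lemma functionally_bounded_witness (p : \bar R) (A : set X) :
    (1 <= p)%E -> functionally_bounded K A -> infinite_set A ->
  exists (chi : nat -> dual Cp) (h : nat -> Cp),
    [/\ weak_star_summable p chi, h @ \oo --> (0 : Cp) &
        forall n, chi n (h n) = 1].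
Proof.
move=> p1 fbA /(@disjoint_bumps R s X tX) [x [g [Ax gx gd]]].
have [chi chiE] := choice (fun n => scaled_evaluation (emb (2^-1 ^+ n)) (x n)).
exists chi, (fun n => (emb (2 ^+ n) : K) *: (g n : Cp)); split.
- move=> f; have [M fM] := (functionally_boundedP A).1 fbA f.
  apply: (@ell_geometric _ _ _ M) => // n.
  rewrite chiE modulusM modulus_emb ger0_norm ?mulr_ge0 ?modulus_ge0 //.
  rewrite ger0_norm ?exprn_ge0 ?invr_ge0 // mulrC ler_wpM2r ?exprn_ge0
    ?invr_ge0 //.
  exact: fM.
- apply: eventually0_cvg => y.
  have g0 n : g n y = 0 -> Cp_eval y ((emb (2 ^+ n) : K) *: (g n : Cp)) = 0.
    by move=> g0; rewrite -[LHS]/(emb (2 ^+ n) * g n y) g0 mulr0.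
  have [[m gm]|ng] := pselect (exists m, g m y <> 0); last first.
    by exists 0%N => n _; apply: g0; apply: contrapT => gn; apply: ng; exists n.
  exists m.+1 => n mn; apply: g0; apply: contrapT => gn.
  by have := gd _ _ _ gm gn => mnE; rewrite mnE ltnn in mn.
- move=> n; rewrite chiE -[Cp_eval _ _]/(emb (2 ^+ n) * g n (x n)) gx mulr1.
  by rewrite -embM -exprMn mulVf // expr1n emb1.
Qed.

(** An equicontinuous sequence chi_n would be uniformly small on the null
    sequence h_n, but chi_n h_n = 1. *)
Lemma p_barrelled_finite (p : \bar R) : (1 <= p)%E -> p_barrelled Cp p ->
  forall A : set X, functionally_bounded K A -> finite_set A.
Proof.
move=> p1 pb A fbA; apply: contrapT => iA.
have [chi [h [sc h0 ch]]] := functionally_bounded_witness p1 fbA iA.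
have := pb chi sc 0 [set xy | ball xy.1 (2^-1 : K) xy.2].
have e2 : 0 < 2^-1 :> K by rewrite invr_gt0.
move=> /(_ (@entourage_ball K K^o (PosNum e2))) /h0 [N _ /(_ N (leqnn N))].
move=> /= /(_ N I); rewrite linear0 ch -ball_normE /= sub0r normrN normr1.
by rewrite invf_gt1 // => /lt_geF; rewrite ler1n.
Qed.

(** The set to test is the range of the null sequence h_n: it is totally
    bounded and bounded, and every chi_n has seminorm at least 1 over it. *)
Lemma limited_finite (p : \bar R) : (1 <= p)%E ->
  (forall A : set Cp, totally_bounded A -> lc_bounded A ->
    exists2 q, (p <= q)%E & limited p q A) ->
  forall A : set X, functionally_bounded K A -> finite_set A.
Proof.
move=> p1 lim A fbA; apply: contrapT => iA.
have [chi [h [sc h0 ch]]] := functionally_bounded_witness p1 fbA iA.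
have [q pq lh] := lim _ (null_sequence_totally_bounded h0)
  (null_sequence_bounded h0).
have [fin /(ell_cvg0 (le_trans p1 pq)) c0] := lh chi sc.
have ge1 n : 1 <= fine (dual_seminorm (range h) (chi n)).
  rewrite -lee_fin fineK //; apply: ereal_sup_ubound.
  exists (h n); first by left; exists n.
  by rewrite ch modulus1.
move/cvgr0Pnorm_lt/(_ 1 ltr01): c0 => [N _ /(_ N (leqnn N))] /=.
by rewrite ltNge (le_trans (ge1 N)) // ler_norm.
Qed.

End CpNegative.

(** * C_p(X) with finite functionally bounded subsets of X *)

Section FiniteSupports.
Context {R : realType} {s : scalars} {X : topologicalType}.
Local Notation K := (scalar_field R s).
Local Notation C := (continuousType X K^o).
Local Notation Cp := (Cp X K).
Context (tX : tychonoff_space X).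
Context (fbX : forall A : set X, functionally_bounded K A -> finite_set A).

Lemma weakly_bounded_support (B : set (L X K)) : weakly_bounded B ->
  exists D : {fset X}, forall l, B l -> (msupp l `<=` D)%fset.
Proof.
move=> /(supports_functionally_bounded tX) /fbX fS.
exists (fset_set [set x | exists2 l, B l & x \in msupp l]) => l Bl.
by apply/fsubsetP => x xl; rewrite in_fset_set // inE; exists l.
Qed.

(** The chi_n are represented by a weakly bounded sequence in L(X), whose
    supports lie in a common finite set D; e x is a bump isolating x in D. *)
Lemma summable_finite_expansion (p : \bar R) (chi : nat -> dual Cp) :
    (1 <= p)%E -> weak_star_summable p chi ->
  exists (D : {fset X}) (e : X -> Cp), forall n f,
    chi n f = \sum_(x <- D) chi n (e x) * Cp_eval x f.
Proof.
move=> p1 sc.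
have [l lE] := choice (fun n => Cp_dual_pairing tX (chi n)).
have [D lD] : exists D : {fset X}, forall n, (msupp (l n) `<=` D)%fset.
  have [|D BD] := @weakly_bounded_support (range l).
    move=> f; have [M cM] := ell_bounded p1 (sc (f : Cp)).
    exists M => _ [n _ <-]; rewrite -lE.
    exact: le_trans (ler_norm _) (cM n).
  by exists D => n; apply: BD; exists n.
have [e eP] := choice (fun x => @coordinate_function R s X tX D x).
exists D, e => n f; rewrite lE (pairingEw _ (lD n)).
apply: eq_bigr => x _; congr (_ * _).
rewrite lE (@pairing_single _ _ _ _ _ x) ?(eP x).1 ?mulr1 // => y yl yx.
by apply: (eP x).2 => //; exact: (fsubsetP (lD n)).
Qed.

Lemma finite_p_barrelled (p : \bar R) : (1 <= p)%E -> p_barrelled Cp p.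
Proof.
move=> p1 chi sc; have [D [e chiE]] := summable_finite_expansion p1 sc.
have [M MP] : exists M : X -> R, forall x n, modulus (chi n (e x) : K) <= M x.
  have [M MP] := choice (fun x => ell_bounded p1 (sc (e x))).
  by exists M => x n; exact: le_trans (ler_norm _) (MP x n).
pose N : R := \sum_(x <- D) `|M x| + 1.
have N0 : 0 < N by rewrite ltr_wpDl // sumr_ge0.
move=> f0 A; rewrite -entourage_from_ballE => -[k /= k0 kA].
have [r r0 kE] := gt0_emb k0.
have nb x : x \in D ->
    nbhs f0 [set f : Cp | modulus (Cp_eval x f0 - Cp_eval x f : K) < r / N].
  move=> _; apply: (@Cp_eval_continuous X K x f0
    [set k : K^o | modulus (Cp_eval x f0 - k : K) < r / N]).
  by apply/nbhs_scalarP; exists (r / N) => //; rewrite divr_gt0.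
have nbD := @filter_bigI _ _ D (fun x =>
  [set f : Cp | modulus (Cp_eval x f0 - Cp_eval x f : K) < r / N]) (nbhs f0)
    (@nbhs_filter _ f0) nb.
apply: filterS nbD => f fD n _.
apply: kA; rewrite -ball_normE /= kE normr_lt_emb !chiE -sumrB.
apply: le_lt_trans (modulus_sum _ _ _) _.
apply: (@le_lt_trans _ _ (\sum_(x <- D) `|M x| * (r / N))).
  rewrite !big_seq; apply: ler_sum => x xD.
  rewrite -mulrBr modulusM ler_pM ?modulus_ge0 //.
    by rewrite (le_trans (MP x n)) // ler_norm.
  exact: ltW (fD x xD).
rewrite -mulr_suml mulrCA -[ltRHS]mulr1 ltr_pM2l // ltr_pdivrMr // mul1r.
by rewrite /N ltrDl.
Qed.

Lemma finite_limited (p q : \bar R) (A : set Cp) : (1 <= p)%E -> (p <= q)%E ->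
  (forall x, exists M, forall f, A f -> modulus (Cp_eval x f : K) <= M) ->
  limited p q A.
Proof.
move=> p1 pq bA chi sc; have [D [e chiE]] := summable_finite_expansion p1 sc.
have q1 := le_trans p1 pq.
have [M MP] := choice bA.
pose a n := \sum_(x <- D) `|M x| * modulus (chi n (e x) : K).
have a0 n : 0 <= a n by rewrite sumr_ge0 // => x _;
  rewrite mulr_ge0 ?modulus_ge0.
have le_a n : (dual_seminorm A (chi n) <= (a n)%:E)%E.
  apply: ge_ereal_sup => _ [f [Af|->] <-]; rewrite lee_fin; last first.
    by rewrite linear0 modulus0.
  rewrite chiE; apply: le_trans (modulus_sum _ _ _) _.
  apply: ler_sum => x _; rewrite modulusM mulrC ler_wpM2r ?modulus_ge0 //.
  by rewrite (le_trans (MP x f Af)) // ler_norm.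
have ge0 n : (0 <= dual_seminorm A (chi n))%E.
  by apply: ereal_sup_ubound; exists 0; [right|rewrite linear0 modulus0].
have fin n : dual_seminorm A (chi n) \is a fin_num.
  rewrite fin_numElt (lt_le_trans _ (ge0 n)) ?ltNyr //=.
  by rewrite (le_lt_trans (le_a n)) // ltry.
split => //; apply: (@ell_dominated _ _ _ a) => // [n|].
  rewrite !ger0_norm ?fine_ge0 // -lee_fin fineK //; exact: le_a.
apply: (ell_le p1 pq); apply: ell_sum => // [x n|x _].
  by rewrite mulr_ge0 ?modulus_ge0.
by apply: ellZ => //; exact: sc.
Qed.

Lemma Cp_eval_nbhs0 x : nbhs 0 [set f : Cp | modulus (Cp_eval x f : K) < 1].
Proof.
apply: (@Cp_eval_continuous X K x 0 [set k : K^o | modulus (k : K) < 1]).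
apply/nbhs_scalarP; exists 1 => // y.
by rewrite [Cp_eval x 0](_ : _ = 0) // sub0r modulusN.
Qed.

Lemma lc_bounded_pointwise (A : set Cp) x : lc_bounded A ->
  exists M, forall f, A f -> modulus (Cp_eval x f : K) <= M.
Proof.
move=> /(_ _ (Cp_eval_nbhs0 x)) [r r0 Ar]; exists (modulus r) =>
  f /Ar [u /= u1 <-].
rewrite -[Cp_eval _ _]/(r * Cp_eval x u) modulusM ler_piMr ?modulus_ge0 //.
exact: ltW.
Qed.

Lemma totally_bounded_pointwise (A : set Cp) x : totally_bounded A ->
  exists M, forall f, A f -> modulus (Cp_eval x f : K) <= M.
Proof.
move=> /(_ _ (Cp_eval_nbhs0 x)) [D /finite_seqP [r ->] AD].
exists (\sum_(d <- r) modulus (Cp_eval x d : K) + 1) =>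
  f /AD [d /= dr [u u1 <-]].
rewrite -[Cp_eval _ _]/(Cp_eval x d + Cp_eval x u).
rewrite (le_trans (modulusD _ _)) // lerD ?(ltW u1) //.
rewrite (big_rem d) //= lerDl sumr_ge0 // => y _; exact: modulus_ge0.
Qed.

End FiniteSupports.

(** * Completeness of L(X) under a compatible topology *)

Section Completeness.
Context {R : realType} {s : scalars}.
Local Notation K := (scalar_field R s).
Context {E : tvsType K}.

Lemma compact_lc_complete (A : set E) : compact A -> lc_complete A.
Proof.
move=> cA F PF FA Fc; have [x [Ax xF]] := cA F PF FA.
exists x => // U xU.
have [q [sq cq qU]] := seminorm_basis (nbhs0_translate xU).
have e2 : 0 < 2^-1 :> R by rewrite invr_gt0.
have [B FB BB] := Fc _ (cq _ e2).
have [z [Bz qz]] := xF _ _ FB (nbhs_translate0 x (cq _ e2)).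
apply: filterS FB => y By; rewrite -[y](subrKC x); apply: qU.
rewrite -[y](subrK z) -addrA (le_lt_trans (sq.1 _ _)) //.
by rewrite [ltRHS]splitr mul1r ltrD //; exact: BB.
Qed.

Lemma cvg_cluster_point (u : nat -> E) l : u @ \oo --> l -> cluster (u @ \oo) l.
Proof.
move=> ul A B uA lB; have : (u @ \oo) (A `&` B) by apply: filterI => //;
  exact: ul.
exact: filter_ex.
Qed.

End Completeness.

Lemma mul_half_pow_lt1 (R : realType) (M : R) :
  exists N, forall n, (N <= n)%N -> M * 2^-1 ^+ n < 1.
Proof.
have : (fun n => M * 2^-1 ^+ n) @ \oo --> (0 : R).
  rewrite -(mulr0 M); apply: cvgMl_tmp; apply: cvg_expr.
  by rewrite ger0_norm // invf_lt1 // ltr1n.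
move=> /cvgr0Pnorm_lt /(_ 1 ltr01) [N _ NM].
by exists N => n /NM; exact: le_lt_trans (ler_norm _).
Qed.

Section FreeSpace.
Context {R : realType} {s : scalars} {X : topologicalType}.
Local Notation K := (scalar_field R s).
Local Notation C := (continuousType X K^o).
Context (T : lc_topology (L X K)) (cT : compatible T).
Local Notation LT := (lc_space T).

Lemma pairing_continuous (f : C) : exists phi : {linear LT -> K^o},
  continuous phi /\ forall l : LT, phi l = pairing (l : L X K) f.
Proof.
pose ev (l : LT) : K^o := pairing (l : L X K) f.
have lin : linear ev.
  by move=> k l m; rewrite /ev -[pairing _ _]/(pairing (k *: (l : L X K) + (m :
    L X K)) f) pairingDl pairingZl.
pose evL : {linear LT -> K^o} := HB.pack ev (GRing.isLinear.Build _ _ _ _ ev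
  lin).
by exists evL; split => //; apply/cT; exists f.
Qed.

Lemma lc_bounded_weakly_bounded (B : set LT) :
  lc_bounded B <-> weakly_bounded (B : set (L X K)).
Proof.
split=> [bB f|wB].
  have [phi [cphi phiE]] := pairing_continuous f.
  have [r r0 Br] := bB _ (continuous_functional_bound cphi).
  exists (modulus r) => l /Br [m /= m1 <-].
  rewrite -[pairing _ _]/(pairing (r *: (m : L X K)) f) pairingZl -phiE.
  by rewrite modulusM ler_piMr ?modulus_ge0 // ltW.
apply: weakly_bounded_bounded => phi /cT [f fE].
have [M BM] := wB f; exists M => l Bl.
by rewrite fE; exact: BM.
Qed.

(** These polars are closed, absolutely convex and weakly bounded, and every
    weakly bounded set lies in one of them: they serve to pass to closed hulls.
    *)
Definition weak_ball (M : C -> R) : set LT :=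
  [set l | forall f : C, modulus (pairing (l : L X K) f) <= M f].

Lemma weak_ball_closed M : closed (weak_ball M).
Proof.
rewrite (_ : weak_ball M =
  \bigcap_(f in [set: C]) [set l : LT | modulus (pairing (l : L X K) f) <= M
    f]).
  apply: closed_bigI => f _; have [phi [cphi phiE]] := pairing_continuous f.
  rewrite (_ : [set l | _] = (fun l => modulus (phi l : K)) @^-1` [set r | r <=
    M f]).
    apply: closed_comp => [l _|]; last exact: closed_le.
    apply: (@continuous_comp LT K^o R phi modulus); first exact: cphi.
    exact: modulus_continuous.
  by apply/seteqP; split => l /=; rewrite phiE.
by apply/seteqP; split => [l Ml f _|l Ml f]; exact: Ml.
Qed.

Lemma weak_ball_absolutely_convex M : absolutely_convex (weak_ball M).
Proof.
move=> a b l m ab Ml Mm f.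
rewrite -[pairing _ _]/(pairing (a *: (l : L X K) + b *: (m : L X K)) f).
rewrite pairingDl !pairingZl (le_trans (modulusD _ _)) // !modulusM.
have M0 : 0 <= M f by apply: le_trans (Ml f); exact: modulus_ge0.
move: ab; rewrite !normr_modulus -embD -emb1 ler_emb => ab.
apply: (@le_trans _ _ ((modulus a + modulus b) * M f)).
  by rewrite mulrDl lerD // ler_wpM2l ?modulus_ge0.
by rewrite ler_piMl.
Qed.

Lemma weakly_bounded_ball (B : set LT) : weakly_bounded (B : set (L X K)) ->
  exists M, B `<=` weak_ball M.
Proof. by move=> /choice [M BM]; exists M => l Bl f; exact: BM. Qed.

Lemma weak_ball_weakly_bounded M : weakly_bounded (weak_ball M : set (L X K)).
Proof. by move=> f; exists (M f) => l; exact. Qed.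

Lemma quasi_sequentially_complete : quasi_complete LT -> sequentially_complete
  LT.
Proof.
move=> qc u uc.
have [M uM] := weakly_bounded_ball ((lc_bounded_weakly_bounded _).1
  (cauchy_sequence_bounded uc)).
have bM := (lc_bounded_weakly_bounded _).2 (@weak_ball_weakly_bounded M).
have [|l _ ul] := qc _ (@weak_ball_closed M) bM (u @ \oo) _ _ uc;
  last by exists l.
by exists 0%N => // n _; apply: uM; exists n.
Qed.

Lemma finite_span_compact (D : seq X) (M : R) : exists2 Q : set LT, compact Q &
  forall a : X -> K, (forall x, x \in D -> modulus (a x) <= M) ->
    Q (\sum_(x <- D) a x *: (<< x >> : L X K)).
Proof.
elim: D => [|x D [Q cQ DQ]].
  by exists [set 0]; [exact: compact_set1|move=> a _; rewrite big_nil].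
have [Z cZ ZM] := @disc_compact R s M.
pose add (z : K^o * LT) : LT := z.1 *: (<< x >> : LT) + z.2.
exists (add @` (Z `*` Q)).
  apply: continuous_compact; last exact: compact_setX.
  apply: continuous_subspaceT => z.
  have c1 : (w.1, << x >> : LT) @[w --> z] --> (z.1, << x >> : LT).
    exact: (cvg_pair cvg_fst (cvg_cst _)).
  have c2 : w.1 *: (<< x >> : LT) @[w --> z] --> z.1 *: (<< x >> : LT).
    have sc := @scale_continuous K LT (z.1, << x >> : LT). exact: (cvg_comp _ _
      c1 sc).
  have c3 : (w.1 *: (<< x >> : LT), w.2) @[w --> z] --> (z.1 *: (<< x >> : LT),
    z.2).
    exact: (cvg_pair c2 cvg_snd).
  exact: (cvg_comp _ _ c3 (@add_continuous LT (z.1 *: (<< x >> : LT), z.2))).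
move=> a aM; exists (a x, \sum_(y <- D) a y *: (<< y >> : L X K)); last first.
  by rewrite big_cons.
split; first by apply: ZM; apply: aM; rewrite mem_head.
by apply: DQ => y yD; apply: aM; rewrite inE yD orbT.
Qed.

Context (tX : tychonoff_space X).

(** All elements of A are supported in one finite set D and have bounded
    coordinates, so A is a closed subset of a compact set. *)
Lemma finite_weakly_bounded_compact (A : set LT) :
    (forall B : set X, functionally_bounded K B -> finite_set B) ->
  closed A -> weakly_bounded (A : set (L X K)) -> compact A.
Proof.
move=> fbX clA wA; have [D AD] := weakly_bounded_support tX fbX wA.
have [e eP] := choice (fun x => @coordinate_function R s X tX D x).
have [M MP] := choice (fun x => wA (e x)).
have [Q cQ DQ] := finite_span_compact D (\sum_(x <- D) `|M x|).
apply: subclosed_compact clA cQ _ => l Al.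
have -> : l = \sum_(x <- D) (l : L X K)@_x *: (<< x >> : L X K).
  rewrite [LHS](@L_decomp R s X); apply: big_fset_incl; first exact: AD.
  by move=> x _ xl; rewrite mcoeff_outdom // scale0r.
apply: DQ => x xD.
have <- : pairing (l : L X K) (e x) = (l : L X K)@_x.
  rewrite (@pairing_single _ _ _ _ _ x) ?(eP x).1 ?mulr1 // => y yl yx.
  by apply: (eP x).2 => //; exact: (fsubsetP (AD l Al)).
rewrite (le_trans (MP x l Al)) // (le_trans (ler_norm _)) //.
by rewrite (big_fsetD1 x) //= lerDl sumr_ge0.
Qed.

Lemma finite_quasi_complete :
    (forall B : set X, functionally_bounded K B -> finite_set B) ->
  quasi_complete LT.
Proof.
move=> fbX A clA bA; apply: compact_lc_complete.
by apply: finite_weakly_bounded_compact => //; apply/lc_bounded_weakly_bounded.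
Qed.

Lemma finite_locally_complete :
    (forall B : set X, functionally_bounded K B -> finite_set B) ->
  locally_complete LT.
Proof.
move=> fbX u u0.
have [M uM] := weakly_bounded_ball ((lc_bounded_weakly_bounded _).1
  (null_sequence_bounded u0)).
apply: finite_weakly_bounded_compact => //; first exact: closed_closure.
suff HM : closure (smallest absolutely_convex (range u)) `<=` weak_ball M.
  by move=> f; exists (M f) => l /HM; exact.
rewrite ((closure_id (weak_ball M)).1 (@weak_ball_closed M)).
apply: closureS; apply: smallest_sub => //; exact: weak_ball_absolutely_convex.
Qed.

Section DiracSums.
Context (A : set X) (x : nat -> X) (g : nat -> C).
Context (fbA : functionally_bounded K A) (Ax : forall n, A (x n)).
Context (gx : forall n, g n (x n) = 1).
Context (gd : forall m n y, g m y <> 0 -> g n y <> 0 -> m = n).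

Definition null_dirac n : LT := (emb (2^-1 ^+ n) : K) *: (<< x n >> : L X K).
(** The weights 2^-(n+1) have sum at most 1, so that these sums lie in the
    absolutely convex hull of the null sequence. *)
Definition dirac_sum N : LT :=
  \sum_(n < N) (emb (2^-1 ^+ n.+1) : K) *: null_dirac n.

(** A compatible topology has the same bounded sets as the weak topology, and
    the Dirac measures at points of A are weakly bounded. *)
Lemma dirac_seminorm (q : LT -> R) : continuous_seminorm q ->
  exists2 M, 0 <= M & forall n, q (<< x n >> : L X K) <= M.
Proof.
move=> cq; have : lc_bounded (range (fun n => (<< x n >> : L X K) : LT)).
  apply/lc_bounded_weakly_bounded => f.
  have [M fM] := (functionally_boundedP A).1 fbA f.
  by exists M => _ [n _ <-]; rewrite pairing_dirac; exact: fM.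
move=> /lc_boundedP /(_ q cq) [M xM].
have xM' n : q (<< x n >> : L X K) <= M by apply: xM; exists n.
exists M => //; exact: le_trans (seminorm_ge0 cq.1 _) (xM' 0%N).
Qed.

Lemma null_dirac_cvg : null_dirac @ \oo --> (0 : LT).
Proof.
move=> U /seminorm_basis [q [sq cq qU]].
have [M M0 xM] := dirac_seminorm (conj sq cq).
have [N NM] := mul_half_pow_lt1 M; exists N => // n Nn.
apply: qU; rewrite sq.2 modulus_emb ger0_norm ?exprn_ge0 //.
by apply: le_lt_trans (NM n Nn); rewrite mulrC ler_wpM2r ?exprn_ge0.
Qed.

Lemma dirac_sum_cauchy : lc_cauchy (dirac_sum @ \oo).
Proof.
move=> U /seminorm_basis [q [sq cq qU]].
have [M M0 xM] := dirac_seminorm (conj sq cq).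
have h0 n : 0 <= 2^-1 ^+ n :> R by rewrite exprn_ge0.
(* The q-norm of the k-th term is at most 2^-(k+1) M = M (2^-k - 2^-(k+1)). *)
have dist m n : (n <= m)%N ->
    q (dirac_sum m - dirac_sum n) <= M * (2^-1 ^+ n - 2^-1 ^+ m).
  move=> /subnK <-; elim: (m - n)%N => [|k IH].
    by rewrite add0n !subrr (seminorm0 sq) mulr0.
  rewrite addSn /dirac_sum big_ord_recr /= -/(dirac_sum _) addrAC.
  rewrite (le_trans (sq.1 _ _)) //.
  have -> : M * (2^-1 ^+ n - 2^-1 ^+ (k + n).+1) =
      M * (2^-1 ^+ n - 2^-1 ^+ (k + n)) + 2^-1 ^+ (k + n).+1 * M.
    by rewrite [2^-1 ^+ _.+1]exprS; field.
  apply: lerD; first exact: IH.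
  rewrite !sq.2 !modulus_emb !ger0_norm //; apply: ler_wpM2l => //.
  rewrite -[leRHS]mul1r ler_pM ?(seminorm_ge0 sq) //.
  by rewrite exprn_ile1 // invf_le1 // ler1n.
have [N NM] := mul_half_pow_lt1 M.
have close m n : (N <= n)%N -> (n <= m)%N -> q (dirac_sum m - dirac_sum n) < 1.
  move=> Nn nm; apply: le_lt_trans (NM n Nn).
  rewrite (le_trans (dist _ _ nm)) //.
  by rewrite ler_wpM2l // lerBlDr lerDl.
exists [set dirac_sum n | n in [set n | (N <= n)%N]].
  by exists N => // n Nn /=; exists n.
move=> _ _ [m Nm <-] [n Nn <-]; apply: qU.
have [mn|/ltnW nm] := leqP m n; last exact: close.
by rewrite -(seminormN sq) opprB; exact: close.
Qed.

(** The support of l is finite, so some g_m vanishes on it: pairing with g_m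
    gives 0 at l, but a constant c > 0 at all partial sums after m. *)
Lemma dirac_sum_cluster l : ~ cluster (dirac_sum @ \oo) l.
Proof.
move=> cl.
have [m gm] : exists m, forall y, y \in msupp (l : L X K) -> g m y = 0.
  have avoid (D : seq X) : exists N, forall n, (N <= n)%N ->
      forall y, y \in D -> g n y = 0.
    elim: D => [|y D [N NP]]; first by exists 0%N.
    have [[k gk]|ng] := pselect (exists k, g k y <> 0); last first.
      exists N => n Nn z; rewrite inE => /orP[/eqP ->|]; last exact: NP.
      by apply: contrapT => gn; apply: ng; exists n.
    exists (maxn N k.+1) => n; rewrite geq_max => /andP[Nn kn] z.
    rewrite inE => /orP[/eqP ->|]; last exact: NP.
    apply: contrapT => gn; have kE := gd gk gn.
    by rewrite kE ltnn in kn.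
  have [N NP] := avoid (msupp (l : L X K)).
  by exists N; exact: NP.
have [phi [cphi phiE]] := pairing_continuous (g m).
pose c : R := 2^-1 ^+ m.+1 * 2^-1 ^+ m.
have c0 : 0 < c by rewrite mulr_gt0 // exprn_gt0.
have gmx n : g m (x n) = (m == n)%:R.
  case: eqVneq => [->|mn]; first exact: gx.
  apply: contrapT => gn; move/eqP: mn; apply; apply: gd gn _.
  by rewrite gx; apply/eqP; exact: oner_neq0.
have sumE n : (m < n)%N -> phi (dirac_sum n) = emb c.
  move=> mn; rewrite phiE /dirac_sum.
  rewrite (pairing_suml _ _ (fun i : 'I_n => (emb (2^-1 ^+ i.+1) : K) *:
    (null_dirac i : L X K))).
  rewrite (bigD1 (Ordinal mn)) //= big1 ?addr0 => [|i im].
    by rewrite !pairingZl pairing_dirac gmx eqxx mulr1 embM.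
  rewrite !pairingZl pairing_dirac gmx.
  have -> : (m == i :> nat) = false by apply/negbTE; rewrite eq_sym.
  by rewrite !mulr0.
have phil : phi l = 0 by rewrite phiE; exact: pairing_eq0.
have nbl : nbhs l [set z | modulus (phi z : K) < c].
  apply: (cphi l [set k : K^o | modulus (k : K) < c]).
  by apply/nbhs_scalarP; exists c => // y; rewrite phil sub0r modulusN.
have [|z [[n mn <-] /=]] := cl [set dirac_sum n | n in [set n | (m < n)%N]] _ _
  nbl.
  by exists m.+1 => // n mn /=; exists n.
by rewrite sumE // modulus_emb gtr0_norm // ltxx.
Qed.

(** By induction on N for all shifted sequences at once: the sum is half the
    first point plus half the shorter sum for the shifted sequence. *)
Lemma dirac_sum_hull (S : set LT) : absolutely_convex S ->
  (forall n, S (null_dirac n)) -> forall N, S (dirac_sum N).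
Proof.
move=> aS uS N; have h2 : 2^-1 + 2^-1 <= 1 :> R by lra.
have S0 : S 0.
  have := aS 0 0 _ _ _ (uS 0%N) (uS 0%N).
  by rewrite !scale0r addr0 normr0 addr0 ler01 => /(_ isT).
have half k : S (\sum_(n < N) (emb (2^-1 ^+ n.+1) : K) *: null_dirac (k + n)%N).
  elim: N k => [|N IH] k; first by rewrite big_ord0.
  rewrite big_ord_recl /=.
  have -> : \sum_(i < N) (emb (2^-1 ^+ (bump 0 i).+1) : K) *: null_dirac (k +
    bump 0 i)%N =
     (emb 2^-1 : K) *: \sum_(n < N) (emb (2^-1 ^+ n.+1) : K) *: null_dirac
       (k.+1 + n)%N.
    rewrite scaler_sumr; apply: eq_bigr => i _.
    by rewrite scalerA -embM -exprS addSnnS.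
  rewrite expr1; apply: aS => //.
  by rewrite !normr_modulus !modulus_emb -embD -emb1 ler_emb ger0_norm.
by have := half 0%N.
Qed.

End DiracSums.

Lemma complete_finite :
  sequentially_complete LT \/ locally_complete LT ->
  forall A : set X, functionally_bounded K A -> finite_set A.
Proof.
move=> LTc A fbA; apply: contrapT => /(@disjoint_bumps R s X tX) [x [g [Ax gx
  gd]]].
have [l cl] : exists l, cluster (dirac_sum x @ \oo) l.
  case: LTc => [sc|lc].
    have [l sl] := sc _ (dirac_sum_cauchy fbA Ax).
    by exists l; exact: cvg_cluster_point.
  have [|l [_ cl]] := lc _ (null_dirac_cvg fbA Ax) (dirac_sum x @ \oo) _;
    last by exists l.
  exists 0%N => // N _; apply: subset_closure => S [aS uS].
  by apply: dirac_sum_hull => // n; apply: uS; exists n.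
exact: dirac_sum_cluster gx gd l cl.
Qed.

End FreeSpace.

(** * The equivalence *)

Theorem theorem3p8 (R : realType) (s : scalars) (p : \bar R)
    (X : topologicalType) (T : lc_topology (L X (scalar_field R s))) :
  (1 <= p)%E -> tychonoff_space X -> compatible T ->
  [<-> p_barrelled (Cp X (scalar_field R s)) p;
       forall A : set (Cp X (scalar_field R s)),
         totally_bounded A -> limited p +oo A;
       forall A : set (Cp X (scalar_field R s)),
         lc_bounded A -> limited p +oo A;
       forall A : set X,
         functionally_bounded (scalar_field R s) A -> finite_set A;
       forall A : set (Cp X (scalar_field R s)),
         lc_bounded A -> exists2 q : \bar R, (p <= q)%E & limited p q A;
       exists2 q : \bar R, (p <= q)%E &
         forall A : set (Cp X (scalar_field R s)),
           lc_bounded A -> limited p q A;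
       forall q : \bar R, (p <= q)%E ->
         forall A : set (Cp X (scalar_field R s)),
           lc_bounded A -> limited p q A;
       quasi_complete (lc_space T);
       sequentially_complete (lc_space T);
       locally_complete (lc_space T) ].

Proof.
move=> p1 tX cT.
have p_oo : (p <= +oo)%E by exact: leey.
have lim_fin := @limited_finite R s X tX p p1.
have fin_lim fbX q pq A bA :=
  @finite_limited R s X tX fbX p q A p1 pq (fun x => lc_bounded_pointwise x bA).
tfae.
- move=> /(p_barrelled_finite tX p1) fbX A tA.
  by apply: finite_limited => // x; exact: totally_bounded_pointwise.
- move=> lim A bA; apply: fin_lim => //.
  by apply: lim_fin => B tB _; exists +oo%E => //; exact: lim.
- by move=> lim; apply: lim_fin => B _ bB; exists +oo%E => //; exact: lim.
- by move=> fbX A bA; exists +oo%E => //; exact: fin_lim.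
- move=> lim; exists +oo%E => // A bA; apply: fin_lim => //.
  by apply: lim_fin => B _; exact: lim.
- move=> [q0 pq0 lim] q pq A bA; apply: fin_lim => //.
  by apply: lim_fin => B _ bB; exists q0 => //; exact: lim.
- move=> lim; apply: finite_quasi_complete => //.
  by apply: lim_fin => B _ bB; exists +oo%E => //; exact: lim.
- exact: quasi_sequentially_complete.
- move=> sc; apply: finite_locally_complete => //.
  by apply: (complete_finite cT tX); left.
- move=> lc; apply: finite_p_barrelled => //.
  by apply: (complete_finite cT tX); right.
Qed.
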